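(* For every integer $k\ge1$, the Hamming cube $I^k=\{0,1\}^k$, with the metric given by the number of coordinates in which two $k$-tuples differ, satisfies $$PH_0(I^k)\cong(0,1)^{2^k-1}\oplus(0,\infty),$$ $$PH_1(I^k)\cong(1,2)^{k\cdot2^{k-1}-(2^k-1)},$$ $$PH_2(I^k)=0,$$ as $\mathbb{R}_+$-graded $\kappa[\mathbb{R}_+]$-modules, where $(a,b)$ denotes a bar module and $(a,b)^m$ the direct sum of $m$ copies of it.
   Context: Let $\kappa$ be a field and $\mathbb{R}_+=[0,\infty)$. $\kappa[\mathbb{R}_+]$ is the ring of polynomials in one variable $T$ with exponents in $\mathbb{R}_+$ and coefficients in $\kappa$, graded by $\mathbb{R}_+$ with $T^t$ in degree $t$. $\Gamma^a$ denotes a degree shift by $a$, so $\Gamma^a\kappa[\mathbb{R}_+]$ is free on one generator of degree $a$. For $0\le a\le b<\infty$ the bar $(a,b)$ is the graded module $\Gamma^a\kappa[\mathbb{R}_+]/T^{b-a}$ (one generator $\sigma$ of degree $a$ with relation $T^{b-a}\sigma=0$), and $(a,\infty)=\Gamma^a\kappa[\mathbb{R}_+]$. Persistent homology of a metric space $(X,d_X)$: let $\mathbf{X}$ be the simplicial set with $\mathbf{X}_n=X^{n+1}$ (ordered tuples, repetitions allowed), with face map $d_i$ omitting the $i$-th entry and degeneracies repeating entries; let $l_X(x_0,\dots,x_n)=\max_{i,j}d_X(x_i,x_j)$. Then $PC_n(X)=\bigoplus_{\sigma\in\mathbf{X}_n}\Gamma^{l_X(\sigma)}\kappa[\mathbb{R}_+]\cdot\langle\sigma\rangle$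 with differential $d\langle\sigma\rangle=\sum_{i=0}^n(-1)^iT^{l_X(\sigma)-l_X(d_i\sigma)}\langle d_i\sigma\rangle$, and $PH_n(X)$ is its $n$-th homology. *)

(* Defs.v *)
From HB Require Import structures.
From mathcomp Require Import all_boot all_order all_algebra.
From mathcomp Require Import boolp reals interval_inference zify.
From mathcomp Require Import ring_quotient monalg.

Set Implicit Arguments.
Unset Strict Implicit.
Unset Printing Implicit Defensive.

Import Order.TTheory GRing.Theory Num.Theory.
Local Open Scope ring_scope.

Definition nnreal (R : realType) := {nonneg R}.

HB.instance Definition _ (R : realType) := Order.Total.on (nnreal R).

Section NNReal.
Variable R : realType.
Implicit Types x y z : nnreal R.

Definition nnreal0 : nnreal R := NngNum (lexx (0 : R)).
Definition nnrealD x y : nnreal R :=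
  NngNum (addr_ge0 (ge0 x) (ge0 y)).

Lemma nnrealB_subproof x y : 0 <= Num.max (x%:num - y%:num) 0.
Proof. by rewrite le_max lexx orbT. Qed.

(* Truncated: [nnrealB x y = nnreal0] when [x <= y]. *)
Definition nnrealB x y : nnreal R := NngNum (nnrealB_subproof x y).

Definition nnreal_nat (n : nat) : nnreal R := NngNum (ler0n R n).

Lemma nnreal_inj x y : x%:num = y%:num -> x = y.
Proof. exact: val_inj. Qed.

Lemma nnrealDE x y : (nnrealD x y)%:num = x%:num + y%:num.
Proof. by []. Qed.

Lemma nnrealDA : associative nnrealD.
Proof. by move=> x y z; apply: nnreal_inj; rewrite !nnrealDE addrA. Qed.

Lemma nnreal0D : left_id nnreal0 nnrealD.
Proof. by move=> x; apply: nnreal_inj; rewrite nnrealDE add0r. Qed.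

Lemma nnrealD0 : right_id nnreal0 nnrealD.
Proof. by move=> x; apply: nnreal_inj; rewrite nnrealDE addr0. Qed.

Lemma nnrealDC : commutative nnrealD.
Proof. by move=> x y; apply: nnreal_inj; rewrite !nnrealDE addrC. Qed.

Lemma nnrealD_eq0 x y :
  nnrealD x y = nnreal0 -> x = nnreal0 /\ y = nnreal0.
Proof.
move=> /(congr1 (fun z : nnreal R => z%:num)) /eqP.
rewrite nnrealDE paddr_eq0 ?ge0 // => /andP[/eqP x0 /eqP y0].
by split; apply: nnreal_inj.
Qed.

Lemma nnrealDI x : injective (nnrealD x).
Proof.
move=> y z /(congr1 (fun z : nnreal R => z%:num)).
by rewrite !nnrealDE => /addrI ?; apply: nnreal_inj.
Qed.

Lemma nnrealBKC x y : (x <= y)%O -> nnrealD x (nnrealB y x) = y.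
Proof.
move=> xy; apply: nnreal_inj; rewrite nnrealDE /=.
by rewrite max_l ?subr_ge0 // addrC subrK.
Qed.

Lemma nnreal_ge0 x : (nnreal0 <= x)%O.
Proof. exact: (ge0 x). Qed.

HB.instance Definition _ := Choice_isMonomialDef.Build (nnreal R)
  nnrealDA nnreal0D nnrealD0 nnrealD_eq0.
HB.instance Definition _ := MonomialDef_isConomialDef.Build (nnreal R) nnrealDC.

End NNReal.

Section SubQuot.
Variables (A : nzRingType) (M : lmodType A).

Definition submod (S : submodClosed M) := {x : M | x \in S}.
HB.instance Definition _ S := SubChoice.on (submod S).
HB.instance Definition _ S := [SubChoice_isSubLmodule of submod S by <:].

Variable S : submodClosed M.

(* [submodClosed] is stated over semirings and does not provide closure under
   opposite, which [Quotient.quot] requires. *)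
Definition submod_pred : {pred M} := fun x => x \in S.

Lemma submod_pred_zmod : zmod_closed submod_pred.
Proof. exact: GRing.submod_closedB (submodClosedP S). Qed.
HB.instance Definition _ :=
  GRing.isZmodClosed.Build M submod_pred submod_pred_zmod.

Definition quotmod := Quotient.quot submod_pred.
HB.instance Definition _ := GRing.Zmodule.on quotmod.

Local Open Scope quotient_scope.

Definition to_quotmod (x : M) : quotmod := \pi_(Quotient.quot submod_pred) x.

Lemma to_quotmodK (u : quotmod) : to_quotmod (repr u) = u.
Proof. exact: reprK. Qed.

Lemma to_quotmodB : {morph to_quotmod : x y / x - y}.
Proof. exact: ring_quotient.pi_is_zmod_morphism. Qed.

Lemma to_quotmodD : {morph to_quotmod : x y / x + y}.
Proof.
have to0 : to_quotmod 0 = 0 by rewrite -(subrr 0) to_quotmodB subrr.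
move=> x y; rewrite -[in LHS](opprK y) to_quotmodB -(sub0r y) to_quotmodB to0.
by rewrite sub0r opprK.
Qed.

Lemma to_quotmod_eq (x y : M) : (to_quotmod x = to_quotmod y) <-> (x - y \in S).
Proof. rewrite -[x - y \in S]/(x - y \in submod_pred).
by rewrite Quotient.idealrBE; split=> [/eqP|/eqP]. Qed.

Definition quotmod_scale (a : A) (u : quotmod) : quotmod :=
  to_quotmod (a *: repr u).

Lemma quotmod_scaleE a x : quotmod_scale a (to_quotmod x) = to_quotmod (a *: x).
Proof.
apply/to_quotmod_eq; rewrite -scalerBr; apply: rpredZ.
by apply/to_quotmod_eq; rewrite to_quotmodK.
Qed.

Lemma quotmod_scaleA a b u :
  quotmod_scale a (quotmod_scale b u) = quotmod_scale (a * b) u.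
Proof.
by rewrite -(to_quotmodK u) !quotmod_scaleE scalerA.
Qed.

Lemma quotmod_scale1 : left_id 1 quotmod_scale.
Proof. by move=> u; rewrite -(to_quotmodK u) quotmod_scaleE scale1r. Qed.

Lemma quotmod_scaleDr : right_distributive quotmod_scale +%R.
Proof.
move=> a u v; rewrite -(to_quotmodK u) -(to_quotmodK v).
by rewrite -to_quotmodD !quotmod_scaleE scalerDr to_quotmodD.
Qed.

Lemma quotmod_scaleDl u : {morph quotmod_scale^~ u : a b / a + b}.
Proof.
move=> a b; rewrite -(to_quotmodK u) !quotmod_scaleE scalerDl.
by rewrite to_quotmodD.
Qed.

HB.instance Definition _ := GRing.Zmodule_isLmodule.Build A quotmod
  quotmod_scaleA quotmod_scale1 quotmod_scaleDr quotmod_scaleDl.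

Lemma to_quotmod_linear : linear to_quotmod.
Proof. by move=> a x y; rewrite to_quotmodD -quotmod_scaleE. Qed.

HB.instance Definition _ := GRing.isLinear.Build A M quotmod *:%R
  to_quotmod to_quotmod_linear.

End SubQuot.

Section KerIm.
Variables (A : nzRingType) (M N : lmodType A) (f : {linear M -> N}).

Definition kerl : {pred M} := [pred x | f x == 0].
Definition iml : {pred N} := [pred y | `[< exists x, f x = y >]].

Lemma kerl_submod : submod_closed kerl.
Proof.
split=> [|a x y]; rewrite !inE ?linear0 // => /eqP fx /eqP fy.
by rewrite linearP fx fy scaler0 addr0.
Qed.
HB.instance Definition _ := GRing.isSubmodClosed.Build A M kerl
  kerl_submod.

Lemma imlP y : reflect (exists x, f x = y) (y \in iml).
Proof. exact: asboolP. Qed.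

Lemma iml_submod : submod_closed iml.
Proof.
split=> [|a x y]; first by apply/imlP; exists 0; rewrite linear0.
move=> /imlP[u <-] /imlP[v <-]; apply/imlP.
by exists (a *: u + v); rewrite linearP.
Qed.
HB.instance Definition _ := GRing.isSubmodClosed.Build A N iml
  (GRing.submod_closed_semi iml_submod).

End KerIm.

Section InSub.
Variables (A : nzRingType) (M : lmodType A) (S B : submodClosed M).

Definition insubmod : {pred submod S} := [pred z | val z \in B].

Lemma insubmod_submod : submod_closed insubmod.
Proof.
split=> [|a x y]; rewrite !inE ?linear0 ?rpred0 // => xB yB.
by rewrite linearP rpredD ?rpredZ.
Qed.
HB.instance Definition _ := GRing.isSubmodClosed.Build A (submod S) insubmod
  (GRing.submod_closed_semi insubmod_submod).

End InSub.

Arguments insubmod [A M] S B _.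

(* The monoid algebra of [nnreal R] with coefficients in [kappa]; [<< c *g t >>]
   is the monomial c T^t. *)
Notation polyR R kappa := {malg kappa[nnreal R]}.

Section Graded.
Variables (R : realType) (kappa : fieldType).
Local Notation A := (polyR R kappa).
Implicit Types (s t : nnreal R) (c : kappa).

Definition Tpow t : A := << t >>.

Lemma monomM c c' s t :
  << c *g s >> * << c' *g t >> = << c * c' *g nnrealD s t >> :> A.
Proof. by rewrite malgM_def fgmulUU. Qed.

(* [grading M] : a family of homogeneous components whose internal direct sum
   is [M] ([homog_span] and [homog_indep]), such that the monomials of degree s
   map degree t to degree s + t. *)
Record grading (M : lmodType A) := Grading {
  homog :> nnreal R -> M -> Prop;
  homog0 : forall t, homog t 0;
  homogB : forall t x y, homog t x -> homog t y -> homog t (x - y);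
  homogZ : forall c s t x, homog t x -> homog (nnrealD s t) (<< c *g s >> *: x);
  homog_span : forall x, exists (r : seq (nnreal R)) (y : nnreal R -> M),
    [/\ uniq r, forall t, homog t (y t) & x = \sum_(t <- r) y t];
  homog_indep : forall (r : seq (nnreal R)) (y : nnreal R -> M),
    uniq r -> (forall t, homog t (y t)) -> \sum_(t <- r) y t = 0 ->
    {in r, forall t, y t = 0}
}.

Lemma homogD M (G : grading M) t x y : G t x -> G t y -> G t (x + y).
Proof.
move=> Gx Gy; rewrite -(opprK y); apply: homogB => //.
by rewrite -sub0r; apply: homogB => //; apply: homog0.
Qed.

Lemma homog_sum M (G : grading M) t (I : Type) (r : seq I) (F : I -> M) :
  (forall i, G t (F i)) -> G t (\sum_(i <- r) F i).
Proof.
move=> GF; elim: r => [|i r IH]; first by rewrite big_nil; apply: homog0.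
by rewrite big_cons; apply: homogD.
Qed.

Lemma homog_spanw M (G : grading M) x :
  exists (r : seq (nnreal R)) (y : nnreal R -> M),
    [/\ uniq r, forall t, G t (y t), forall t, t \notin r -> y t = 0 &
        forall r' : seq (nnreal R), uniq r' -> {subset r <= r'} ->
          x = \sum_(t <- r') y t].
Proof.
have [r [y [ur Gy ->]]] := homog_span G x.
exists r, (fun t => if t \in r then y t else 0); split=> //.
- by move=> t; case: ifP => _ //; apply: homog0.
- by move=> t /negPf ->.
move=> r' ur' rr'; rewrite -big_mkcond /= -[RHS]big_filter.
apply: perm_big; apply: uniq_perm; rewrite ?filter_uniq // => t.
rewrite mem_filter; case: (boolP (t \in r)) => //= tr.
by rewrite rr'.
Qed.

Definition homogeneous M (G : grading M) (S : {pred M}) : Prop :=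
  forall (r : seq (nnreal R)) (y : nnreal R -> M),
    uniq r -> (forall t, G t (y t)) -> \sum_(t <- r) y t \in S ->
    {in r, forall t, y t \in S}.

Definition graded_map M N (G : grading M) (H : grading N) (f : M -> N) : Prop :=
  forall t x, G t x -> H t (f x).

Lemma homogeneous_kerl M N (G : grading M) (H : grading N)
    (f : {linear M -> N}) : graded_map G H f -> homogeneous G (kerl f).
Proof.
move=> fgr r y ur Gy; rewrite inE linear_sum => /eqP fy t tr.
rewrite inE; apply/eqP.
exact: (homog_indep (g := H) (y := f \o y) ur (fun t => fgr _ _ (Gy t)) fy).
Qed.

Lemma homogeneous_iml M N (G : grading M) (H : grading N)
    (f : {linear M -> N}) : graded_map G H f -> homogeneous H (iml f).
Proof.
move=> fgr r y ur Hy /imlP[x fx] t tr; apply/imlP.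
have [rx [z [urx Gz z0 xE]]] := homog_spanw G x.
exists (z t); apply/eqP; rewrite -subr_eq0; apply/eqP.
pose y' t := if t \in r then y t else 0.
have Hy' u : H u (y' u) by rewrite /y'; case: ifP => // _; apply: homog0.
have sub : {subset rx <= undup (rx ++ r)}.
  by move=> u ur'; rewrite mem_undup mem_cat ur'.
have : \sum_(u <- undup (rx ++ r)) (f (z u) - y' u) = 0.
  rewrite sumrB -linear_sum -(xE _ (undup_uniq _) sub) fx.
  apply/eqP; rewrite subr_eq0; apply/eqP.
  rewrite -[RHS]big_mkcond /= -[RHS]big_filter.
  apply: perm_big; apply: uniq_perm; rewrite ?filter_uniq ?undup_uniq // => u.
  by rewrite mem_filter mem_undup mem_cat; case: (u \in r); rewrite //= orbT.
move/(homog_indep (g := H) (y := fun u => f (z u) - y' u)) => H0.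
have -> : y t = y' t by rewrite /y' tr.
apply: H0; rewrite ?undup_uniq ?mem_undup ?mem_cat ?tr ?orbT //.
by move=> u; apply: homogB => //; apply: fgr.
Qed.

Section SubGrading.
Variables (M : lmodType A) (G : grading M) (S : submodClosed M).
Hypothesis homS : homogeneous G S.

Fact sub_homog_span (x : submod S) :
  exists (r : seq (nnreal R)) (y : nnreal R -> submod S),
    [/\ uniq r, forall t, G t (val (y t)) & x = \sum_(t <- r) y t].
Proof.
have [r [y [ur Gy y0 xE]]] := homog_spanw G (val x).
have yS t : y t \in S.
  case: (boolP (t \in r)) => [tr|/y0 ->]; last exact: rpred0.
  by apply: (homS ur Gy) => //; rewrite -xE //; apply: valP.
exists r, (fun t => Sub (y t) (yS t)); split=> //.
apply: val_inj; rewrite [LHS](xE r) // raddf_sum.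
by apply: eq_bigr.
Qed.

Fact sub_homog_indep (r : seq (nnreal R)) (y : nnreal R -> submod S) :
  uniq r -> (forall t, G t (val (y t))) -> \sum_(t <- r) y t = 0 ->
  {in r, forall t, y t = 0}.
Proof.
move=> ur Gy /(congr1 val); rewrite raddf_sum raddf0 => y0 t tr.
apply: val_inj; rewrite raddf0.
exact: (homog_indep (y := val \o y) ur Gy y0 tr).
Qed.

Fact sub_homog0 t : G t (val (0 : submod S)).
Proof. by rewrite raddf0; apply: homog0. Qed.
Fact sub_homogB t (x y : submod S) :
  G t (val x) -> G t (val y) -> G t (val (x - y)).
Proof. by rewrite raddfB; apply: homogB. Qed.
Fact sub_homogZ c s t (x : submod S) :
  G t (val x) -> G (nnrealD s t) (val (<< c *g s >> *: x)).
Proof. by rewrite linearZ; apply: homogZ. Qed.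

Definition sub_grading : grading (submod S) :=
  @Grading (submod S) (fun t x => G t (val x))
    sub_homog0 sub_homogB sub_homogZ sub_homog_span sub_homog_indep.

Lemma homogeneous_insubmod (B : submodClosed M) :
  homogeneous G B -> homogeneous sub_grading (insubmod S B).
Proof.
move=> homB r y ur Gy; rewrite inE raddf_sum => yB t tr; rewrite inE.
exact: (homB r (val \o y) ur Gy yB t tr).
Qed.

End SubGrading.

Section QuotGrading.
Variables (M : lmodType A) (G : grading M) (S : submodClosed M).
Hypothesis homS : homogeneous G S.

Definition quot_homog t (u : quotmod S) : Prop :=
  exists2 x, G t x & to_quotmod S x = u.

Fact quot_homog0 t : quot_homog t 0.
Proof. by exists 0; [apply: homog0|rewrite linear0]. Qed.
Fact quot_homogB t u v : quot_homog t u -> quot_homog t v -> quot_homog t (u - v).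
Proof.
move=> [x Gx <-] [y Gy <-].
by exists (x - y); [apply: homogB|rewrite linearB].
Qed.
Fact quot_homogZ c s t u :
  quot_homog t u -> quot_homog (nnrealD s t) (<< c *g s >> *: u).
Proof.
move=> [x Gx <-].
by exists (<< c *g s >> *: x); [apply: homogZ|rewrite linearZ].
Qed.
Fact quot_homog_span u :
  exists (r : seq (nnreal R)) (y : nnreal R -> quotmod S),
    [/\ uniq r, forall t, quot_homog t (y t) & u = \sum_(t <- r) y t].
Proof.
have [r [y [ur Gy xE]]] := homog_span G (repr u).
exists r, (fun t => to_quotmod S (y t)); split=> //.
  by move=> t; exists (y t).
by rewrite -linear_sum -xE [RHS]to_quotmodK.
Qed.
Fact quot_homog_indep (r : seq (nnreal R)) (y : nnreal R -> quotmod S) :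
  uniq r -> (forall t, quot_homog t (y t)) -> \sum_(t <- r) y t = 0 ->
  {in r, forall t, y t = 0}.
Proof.
move=> ur Gy.
have /choice[x xP] : forall t, exists x, G t x /\ to_quotmod S x = y t.
  by move=> t; have [x] := Gy t; exists x.
move=> y0; have : to_quotmod S (\sum_(t <- r) x t) = to_quotmod S 0.
  rewrite linear0 -y0 linear_sum.
  by apply: eq_bigr => t _; have [] := xP t.
move=> /to_quotmod_eq; rewrite subr0 => xS t tr.
have [_ <-] := xP t; transitivity (to_quotmod S 0); last exact: linear0.
apply/to_quotmod_eq; rewrite subr0.
by apply: (homS ur _ xS) => // u; have [] := xP u.
Qed.

Definition quot_grading : grading (quotmod S) :=
  @Grading (quotmod S) quot_homog
    quot_homog0 quot_homogB quot_homogZ quot_homog_span quot_homog_indep.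

End QuotGrading.

Definition reg_homog t (x : A^o) : Prop := exists c, x = << c *g t >>.

Fact reg_homog0 t : reg_homog t 0.
Proof. by exists 0; rewrite monalgU0. Qed.
Fact reg_homogB t x y : reg_homog t x -> reg_homog t y -> reg_homog t (x - y).
Proof. by move=> [c ->] [c' ->]; exists (c - c'); rewrite monalgUB. Qed.
Fact reg_homogZ c s t (x : A^o) :
  reg_homog t x -> reg_homog (nnrealD s t) (<< c *g s >> *: x).
Proof. by move=> [c' ->]; exists (c * c'); rewrite -monomM. Qed.
Fact reg_homog_span (x : A^o) :
  exists (r : seq (nnreal R)) (y : nnreal R -> A^o),
    [/\ uniq r, forall t, reg_homog t (y t) & x = \sum_(t <- r) y t].
Proof.
exists (finmap.enum_fset (msupp (x : A))), (fun t => << mcoeff t (x : A) *g t >>); split.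
- exact: finmap.fset_uniq.
- by move=> t; exists (mcoeff t (x : A)).
- exact: monalgE.
Qed.
Fact reg_homog_indep (r : seq (nnreal R)) (y : nnreal R -> A^o) :
  uniq r -> (forall t, reg_homog t (y t)) -> \sum_(t <- r) y t = 0 ->
  {in r, forall t, y t = 0}.
Proof.
move=> ur Gy y0 t tr; have [c yt] := Gy t.
rewrite yt; suff -> : c = 0 by rewrite monalgU0.
have := congr1 (mcoeff t) (y0 : _ = 0 :> A).
rewrite mcoeff0 raddf_sum (bigD1_seq t) //= yt mcoeffUU big1 ?addr0 //.
move=> u ut; have [c' ->] := Gy u.
by rewrite mcoeffU (negPf ut).
Qed.

Definition reg_grading : grading A^o :=
  @Grading A^o reg_homog reg_homog0 reg_homogB reg_homogZ
    reg_homog_span reg_homog_indep.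

Section Shift.
Variables (M : lmodType A) (G : grading M) (a : nnreal R).

(* Degree t of Gamma^a M is degree t - a of M if a <= t, and 0 otherwise. *)
Definition shift_homog t (x : M) : Prop :=
  x = 0 \/ exists2 s, t = nnrealD a s & G s x.

Fact shift_homogP t x : (a <= t)%O -> shift_homog t x <-> G (nnrealB t a) x.
Proof.
move=> le_at; split=> [[->|[s ts Gx]]|Gx]; first exact: homog0.
  suff -> : nnrealB t a = s by [].
  by apply: (@nnrealDI _ a); rewrite nnrealBKC.
by right; exists (nnrealB t a) => //; rewrite nnrealBKC.
Qed.

Fact shift_homog0 t : shift_homog t 0.
Proof. by left. Qed.
Fact shift_homogB t x y :
  shift_homog t x -> shift_homog t y -> shift_homog t (x - y).
Proof.
have [at_|ta] := boolP (a <= t)%O.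
  by move=> /(shift_homogP _ at_)? /(shift_homogP _ at_)?;
     apply/(shift_homogP _ at_)/homogB.
have sh0 z : shift_homog t z -> z = 0.
  case=> // -[s ts _]; case/negP: ta; rewrite ts.
  by rewrite -[(a <= _)%O]/(a%:num <= a%:num + s%:num) lerDl.
by move=> /sh0-> /sh0->; rewrite subr0; left.
Qed.
Fact shift_homogZ c s t (x : M) :
  shift_homog t x -> shift_homog (nnrealD s t) (<< c *g s >> *: x).
Proof.
case=> [->|[u -> Gx]]; first by left; rewrite scaler0.
right; exists (nnrealD s u); last exact: homogZ.
by rewrite !nnrealDA (nnrealDC s).
Qed.
Fact shift_homog_span x :
  exists (r : seq (nnreal R)) (y : nnreal R -> M),
    [/\ uniq r, forall t, shift_homog t (y t) & x = \sum_(t <- r) y t].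
Proof.
have [r [y [ur Gy ->]]] := homog_span G x.
exists (map (nnrealD a) r),
  (fun t => if (a <= t)%O then y (nnrealB t a) else 0); split.
- by rewrite map_inj_uniq //; apply: nnrealDI.
- move=> t; case: ifP => [at_|_]; last by left.
  exact/(shift_homogP _ at_).
- rewrite big_map; apply: eq_bigr => t _.
  have at_ : (a <= nnrealD a t)%O.
    by rewrite -[(a <= _)%O]/(a%:num <= a%:num + t%:num) lerDl.
  rewrite at_; congr y; apply: (@nnrealDI _ a).
  by rewrite nnrealBKC.
Qed.
Fact shift_homog_indep (r : seq (nnreal R)) (y : nnreal R -> M) :
  uniq r -> (forall t, shift_homog t (y t)) -> \sum_(t <- r) y t = 0 ->
  {in r, forall t, y t = 0}.
Proof.
move=> ur Gy y0 t tr.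
have [|ta] := boolP (a <= t)%O; last first.
  case: (Gy t) => // -[s ts _]; case/negP: ta; rewrite ts.
  by rewrite -[(a <= _)%O]/(a%:num <= a%:num + s%:num) lerDl.
move=> at_.
pose r' := [seq nnrealB u a | u <- r & (a <= u)%O].
have r'U : uniq r'.
  rewrite map_inj_in_uniq ?filter_uniq // => u v.
  rewrite !mem_filter => /andP[au _] /andP[av _] uv.
  by rewrite -(nnrealBKC au) uv nnrealBKC.
have aD u : (a <= nnrealD a u)%O.
  by rewrite -[(a <= _)%O]/(a%:num <= a%:num + u%:num) lerDl.
have DB u : nnrealB (nnrealD a u) a = u.
  by apply: (@nnrealDI _ a); rewrite nnrealBKC.
have Gy' u : G u (y (nnrealD a u)).
  by have /(shift_homogP _ (aD u)) := Gy (nnrealD a u); rewrite DB.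
have y'0 : \sum_(u <- r') y (nnrealD a u) = 0.
  rewrite big_map big_filter -[RHS]y0 [RHS](bigID (fun u => (a <= u)%O)) /=.
  rewrite [X in _ = _ + X]big1 ?addr0.
    by apply: eq_bigr => u au; rewrite nnrealBKC.
  move=> u ua; case: (Gy u) => // -[s us _]; case/negP: ua.
  by rewrite us aD.
have := homog_indep r'U Gy' y'0.
move=> /(_ (nnrealB t a)); rewrite nnrealBKC //; apply.
by apply/mapP; exists t => //; rewrite mem_filter at_.
Qed.

Definition shift_grading : grading M :=
  @Grading M shift_homog shift_homog0 shift_homogB shift_homogZ
    shift_homog_span shift_homog_indep.

End Shift.

Section FinSum.
Variables (I : finType) (M : lmodType A) (G : I -> grading M).

(* The direct sum over [I] of copies of [M], the i-th copy graded by [G i]. *)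
Definition dsum_homog t (f : {ffun I -> M}) : Prop := forall i, G i t (f i).

Fact dsum_homog0 t : dsum_homog t 0.
Proof. by move=> i; rewrite ffunE; apply: homog0. Qed.
Fact dsum_homogB t f g : dsum_homog t f -> dsum_homog t g -> dsum_homog t (f - g).
Proof. by move=> Gf Gg i; rewrite !ffunE; apply: homogB. Qed.
Fact dsum_homogZ c s t (f : {ffun I -> M}) :
  dsum_homog t f -> dsum_homog (nnrealD s t) (<< c *g s >> *: f).
Proof. by move=> Gf i; rewrite ffunE; apply: homogZ. Qed.
Fact dsum_homog_span (f : {ffun I -> M}) :
  exists (r : seq (nnreal R)) (y : nnreal R -> {ffun I -> M}),
    [/\ uniq r, forall t, dsum_homog t (y t) & f = \sum_(t <- r) y t].
Proof.
have /choice[r rP] := fun i => homog_spanw (G i) (f i).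
have /choice[y yP] := rP.
exists (undup (flatten [seq r i | i <- enum I])), (fun t => [ffun i => y i t]).
split; first exact: undup_uniq.
  by move=> t i; rewrite ffunE; have [] := yP i.
apply/ffunP => i; rewrite sum_ffunE.
under eq_bigr do rewrite ffunE.
have [_ _ _] := yP i; apply; first exact: undup_uniq.
move=> t tr; rewrite mem_undup; apply/flattenP; exists (r i) => //.
by apply: map_f; rewrite mem_enum.
Qed.
Fact dsum_homog_indep (r : seq (nnreal R)) (y : nnreal R -> {ffun I -> M}) :
  uniq r -> (forall t, dsum_homog t (y t)) -> \sum_(t <- r) y t = 0 ->
  {in r, forall t, y t = 0}.
Proof.
move=> ur Gy y0 t tr; apply/ffunP => i; rewrite ffunE.
apply: (homog_indep (g := G i) (y := fun t => y t i) ur) => //.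
  by move=> u; apply: Gy.
by rewrite -sum_ffunE y0 ffunE.
Qed.

Definition dsum_grading : grading {ffun I -> M} :=
  @Grading {ffun I -> M} dsum_homog dsum_homog0 dsum_homogB dsum_homogZ
    dsum_homog_span dsum_homog_indep.

End FinSum.

Section PairSum.
Variables (M N : lmodType A) (G : grading M) (H : grading N).

Definition pair_homog t (x : (M * N)%type) : Prop := G t x.1 /\ H t x.2.

Fact pair_homog0 t : pair_homog t 0.
Proof. by split; apply: homog0. Qed.
Fact pair_homogB t x y : pair_homog t x -> pair_homog t y -> pair_homog t (x - y).
Proof. by move=> [? ?] [? ?]; split; apply: homogB. Qed.
Fact pair_homogZ c s t (x : (M * N)%type) :
  pair_homog t x -> pair_homog (nnrealD s t) (<< c *g s >> *: x).
Proof. by move=> [? ?]; split; apply: homogZ. Qed.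

Let sum_fst (r : seq (nnreal R)) (y : nnreal R -> (M * N)%type) :
  (\sum_(t <- r) y t).1 = \sum_(t <- r) (y t).1.
Proof. by apply: (big_morph fst). Qed.
Let sum_snd (r : seq (nnreal R)) (y : nnreal R -> (M * N)%type) :
  (\sum_(t <- r) y t).2 = \sum_(t <- r) (y t).2.
Proof. by apply: (big_morph snd). Qed.

Fact pair_homog_span (x : (M * N)%type) :
  exists (r : seq (nnreal R)) (y : nnreal R -> (M * N)%type),
    [/\ uniq r, forall t, pair_homog t (y t) & x = \sum_(t <- r) y t].
Proof.
have [r [y [_ Gy _ yE]]] := homog_spanw G x.1.
have [r' [z [_ Hz _ zE]]] := homog_spanw H x.2.
exists (undup (r ++ r')), (fun t => (y t, z t)).
split; [exact: undup_uniq|by move=> t; split|].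
rewrite [LHS]surjective_pairing [RHS]surjective_pairing sum_fst sum_snd.
congr pair; [apply: yE|apply: zE]; rewrite ?undup_uniq // => t tr;
  by rewrite mem_undup mem_cat tr ?orbT.
Qed.
Fact pair_homog_indep (r : seq (nnreal R)) (y : nnreal R -> (M * N)%type) :
  uniq r -> (forall t, pair_homog t (y t)) -> \sum_(t <- r) y t = 0 ->
  {in r, forall t, y t = 0}.
Proof.
move=> ur Gy y0 t tr; rewrite [LHS]surjective_pairing [RHS]surjective_pairing.
congr pair.
- apply: (homog_indep (g := G) (y := fst \o y) ur) => //.
    by move=> u; have [] := Gy u.
  by rewrite -sum_fst y0.
- apply: (homog_indep (g := H) (y := snd \o y) ur) => //.
    by move=> u; have [] := Gy u.
  by rewrite -sum_snd y0.
Qed.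

Definition pair_grading : grading (M * N)%type :=
  @Grading (M * N)%type pair_homog pair_homog0 pair_homogB pair_homogZ
    pair_homog_span pair_homog_indep.

End PairSum.

Record gradedModule := GradedModule {
  gmod_carrier :> lmodType A;
  gmod_grading : grading gmod_carrier
}.

(* Isomorphism in the category of graded modules and degree-preserving
   kappa[R_+]-linear maps. *)
Definition graded_iso (M N : gradedModule) : Prop :=
  exists f : {linear M -> N}, bijective f /\
    forall t x, gmod_grading M t x <-> gmod_grading N t (f x).

Definition gmod_shift (a : nnreal R) (M : gradedModule) : gradedModule :=
  GradedModule (shift_grading (gmod_grading M) a).

Definition gmod_dsum (M N : gradedModule) : gradedModule :=
  GradedModule (pair_grading (gmod_grading M) (gmod_grading N)).

Definition gmod_power (M : gradedModule) (m : nat) : gradedModule :=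
  GradedModule (dsum_grading (fun _ : 'I_m => gmod_grading M)).

Definition gmod_reg : gradedModule := GradedModule reg_grading.

Definition Tideal (s : nnreal R) : {pred A^o} :=
  [pred x | `[< exists y : A, x = y * Tpow s >]].

Lemma TidealP s (x : A^o) :
  reflect (exists y : A, x = y * Tpow s) (x \in Tideal s).
Proof. exact: asboolP. Qed.

Fact Tideal_submod s : submod_closed (Tideal s).
Proof.
split=> [|a x y]; first by apply/TidealP; exists 0; rewrite mul0r.
move=> /TidealP[u ->] /TidealP[v ->]; apply/TidealP; exists (a * u + v).
by rewrite mulrDl -mulrA.
Qed.
HB.instance Definition _ s :=
  GRing.isSubmodClosed.Build A A^o (Tideal s) (Tideal_submod s).

Fact Tideal_homogeneous s a :
  homogeneous (shift_grading reg_grading a) (Tideal s).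
Proof.
pose f (x : A^o) : A^o := x * Tpow s.
have f_linear : linear f.
  by move=> c x y; rewrite /f mulrDl -[c *: x]/(c * x) -mulrA.
pose F : {linear A^o -> A^o} :=
  HB.pack f (GRing.isLinear.Build A A^o A^o *:%R f f_linear).
have Fgr : graded_map (shift_grading (shift_grading reg_grading a) s)
    (shift_grading reg_grading a) F.
  move=> t x [->|[u -> [->|[v -> [c ->]]]]]; rewrite -[F _]/(f _) /f.
  - by rewrite mul0r; left.
  - by rewrite mul0r; left.
  right; exists (nnrealD s v); first by rewrite !nnrealDA (nnrealDC s).
  by exists c; rewrite /Tpow monomM mulr1 nnrealDC.
move=> r y ur Gy yS t tr.
have /imlP[x Fx] : y t \in iml F.
  apply: (homogeneous_iml Fgr ur Gy) => //.
  by move/TidealP: yS => [x ->]; apply/imlP; exists x.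
by apply/TidealP; exists x.
Qed.

(* (a, b) = Gamma^a kappa[R_+] / T^(b - a), for a <= b. *)
Definition bar (a b : nnreal R) : gradedModule :=
  @GradedModule (quotmod (Tideal (nnrealB b a)))
    (quot_grading (@Tideal_homogeneous (nnrealB b a) a)).

(* (a, oo) = Gamma^a kappa[R_+] *)
Definition bar_infty (a : nnreal R) : gradedModule := gmod_shift a gmod_reg.

End Graded.

Record finMetricSpace (R : realType) := FinMetricSpace {
  fms_carrier :> finType;
  fms_dist : fms_carrier -> fms_carrier -> nnreal R;
  fms_dist_eq0 : forall x y, fms_dist x y = nnreal0 R <-> x = y;
  fms_distC : forall x y, fms_dist x y = fms_dist y x;
  fms_dist_triangle : forall x y z,
    (fms_dist x z)%:num <= (fms_dist x y)%:num + (fms_dist y z)%:num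
}.

Section Persistent.
Variables (R : realType) (kappa : fieldType) (X : finMetricSpace R).
Local Notation A := (polyR R kappa).

Definition simplex (n : nat) := n.+1.-tuple X.

Definition face n (i : 'I_n.+2) (s : simplex n.+1) : simplex n :=
  [tuple tnth s (lift i j) | j < n.+1].

Definition diam n (s : simplex n) : nnreal R :=
  \big[Order.max/nnreal0 R]_(i < n.+1) \big[Order.max/nnreal0 R]_(j < n.+1)
    fms_dist (tnth s i) (tnth s j).

Lemma diam_ge n (s : simplex n) i j :
  (fms_dist (tnth s i) (tnth s j) <= diam s)%O.
Proof.
apply: le_trans (le_bigmax _ _ i) => /=.
exact: (le_bigmax _ (fun j => fms_dist (tnth s i) (tnth s j))).
Qed.

Lemma diam_face n (i : 'I_n.+2) (s : simplex n.+1) :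
  (diam (face i s) <= diam s)%O.
Proof.
apply: bigmax_le => [|j _]; first exact: nnreal_ge0.
apply: bigmax_le => [|k _]; first exact: nnreal_ge0.
by rewrite !tnth_mktuple diam_ge.
Qed.

Definition chain (n : nat) := {ffun simplex n -> A^o}.

Definition gen n (s : simplex n) : chain n := [ffun s' => (s' == s)%:R].

Definition chain_grading n : grading (chain n) :=
  dsum_grading (fun s : simplex n => shift_grading (reg_grading R kappa) (diam s)).

(* PC_n(X): for finite X the direct sum over X^(n+1) consists of all families. *)
Definition PC (n : nat) : gradedModule R kappa :=
  GradedModule (chain_grading n).

Definition bd_gen n (s : simplex n.+1) : chain n :=
  \sum_(i < n.+2)
    (-1) ^+ i *: (Tpow kappa (nnrealB (diam s) (diam (face i s))) *: gen (face i s)).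

Definition bd n (f : chain n.+1) : chain n := \sum_s (f s : A) *: bd_gen s.

Fact bd_linear n : linear (@bd n).
Proof.
move=> a f g; rewrite /bd scaler_sumr -big_split /=.
by apply: eq_bigr => s _; rewrite !ffunE scalerA -scalerDl.
Qed.
HB.instance Definition _ n :=
  GRing.isLinear.Build A (chain n.+1) (chain n) *:%R (@bd n) (@bd_linear n).

Lemma bd_graded n : graded_map (chain_grading n.+1) (chain_grading n) (@bd n).
Proof.
move=> t f Gf; apply: homog_sum => s.
rewrite /bd_gen scaler_sumr; apply: homog_sum => i.
move=> s' /=; rewrite !ffunE; case: eqP => [->|_]; last first.
  by rewrite !scaler0; left.
rewrite -[_ *: _]/((f s : A) * ((-1) ^+ i * (Tpow kappa _ * 1))) mulr1.
have [->|[u -> [c ->]]] := Gf s; first by rewrite mul0r; left.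
right; exists (nnrealD u (nnrealB (diam s) (diam (face i s)))).
  rewrite (nnrealDC u) nnrealDA nnrealBKC //; exact: diam_face.
exists ((-1) ^+ i * c).
rewrite mulrCA monomM mulr1 -signr_odd -[in RHS]signr_odd.
by case: (odd i); rewrite ?mul1r // !mulN1r monalgUN.
Qed.

Lemma bd_genE n (s : simplex n.+1) : bd (gen s) = bd_gen s.
Proof.
rewrite /bd (bigD1 s) //= ffunE eqxx scale1r big1 ?addr0 // => s' ss'.
by rewrite ffunE (negPf ss') scale0r.
Qed.

Lemma face_face n (i : 'I_n.+3) (j : 'I_n.+2) (s : simplex n.+2)
    (i' : 'I_n.+3) (j' : 'I_n.+2) :
  (j < i)%N -> i' = j :> nat -> j' = i.-1 :> nat ->
  face j (face i s) = face j' (face i' s).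
Proof.
move=> ji ii' jj'; apply: eq_from_tnth => l; rewrite !tnth_mktuple.
congr tnth; apply: val_inj; rewrite /= ii' jj' /bump; lia.
Qed.

Fact scale4 (B : comNzRingType) (M : lmodType B) (a b c d e f : B) (v : M) :
  b * d = f -> a * c = e -> a *: (b *: (c *: (d *: v))) = e *: (f *: v).
Proof. by move=> <- <-; rewrite !scalerA -!mulrA (mulrCA b). Qed.

Lemma bd_bd n (f : chain n.+2) : bd (bd f) = 0.
Proof.
rewrite {2}/bd linear_sum big1 // => s _; rewrite linearZ /=.
suff -> : bd (bd_gen s) = 0 by rewrite scaler0.
pose F (p : 'I_n.+3 * 'I_n.+2) : chain n :=
  (-1) ^+ (p.1 + p.2) *: (Tpow kappa (nnrealB (diam s)
     (diam (face p.2 (face p.1 s)))) *: gen (face p.2 (face p.1 s))).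
have -> : bd (bd_gen s) = \sum_p F p.
  rewrite /bd_gen linear_sum -(pair_bigA _ (fun i j => F (i, j))) /=.
  apply: eq_bigr => i _; rewrite !linearZ /= bd_genE /bd_gen !scaler_sumr.
  apply: eq_bigr => j _; apply: scale4; last by rewrite exprD.
  rewrite /Tpow monomM mulr1; congr << _ >>; apply: nnreal_inj.
  have h1 : (diam (face i s))%:num <= (diam s)%:num := diam_face i s.
  have h2 : (diam (face j (face i s)))%:num <= (diam (face i s))%:num :=
    diam_face j _.
  rewrite nnrealDE /= !max_l ?subr_ge0 //; last exact: le_trans h2 h1.
  by rewrite subrKA.
rewrite (bigID (fun p : 'I_n.+3 * 'I_n.+2 => (p.2 < p.1)%N)) /=.
pose up (p : 'I_n.+3 * 'I_n.+2) : 'I_n.+3 * 'I_n.+2 :=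
  (inord p.2.+1, inord p.1).
pose dn (p : 'I_n.+3 * 'I_n.+2) : 'I_n.+3 * 'I_n.+2 :=
  (inord p.2, inord p.1.-1).
rewrite (reindex_onto up dn) /=; last first.
  move=> [i j] /= ji; rewrite /up /dn /=.
  have lti := ltn_ord i; have ltj := ltn_ord j.
  have ni : (i.-1 < n.+2)%N by lia.
  have nj : (j < n.+3)%N by lia.
  rewrite (inordK ni) (inordK nj).
  by congr pair; apply: val_inj; rewrite /= inordK //; lia.
have E (q : 'I_n.+3 * 'I_n.+2) :
    ((up q).2 < (up q).1)%N && (dn (up q) == q) = ~~ (q.2 < q.1)%N.
  case: q => i j; rewrite /up /dn /= xpair_eqE -!val_eqE /=.
  have ltj := ltn_ord j; have lti := ltn_ord i; rewrite (@inordK _ j.+1) //=.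
  have [ij|ji] := leqP i j.
    by rewrite !inordK ?eqxx ?ltnS ?ij //=; lia.
  have [in2|ni] := leqP i n.+1; first by rewrite inordK //; lia.
  have ltv := ltn_ord (inord i : 'I_n.+2).
  have ltv3 : ((inord i : 'I_n.+2) < n.+3)%N by lia.
  by apply/negP => /andP[_ /andP[/eqP + _]]; rewrite (inordK ltv3); lia.
apply/eqP; rewrite addr_eq0 -sumrN; apply/eqP.
apply: eq_big => [q|[i j]]; first exact: E.
rewrite E /= -leqNgt => ij.
have lti : (i < n.+2)%N by have := ltn_ord j; lia.
have ltj : (j.+1 < n.+3)%N by have := ltn_ord j; lia.
have Ei : (inord i : 'I_n.+2) = i :> nat := inordK lti.
have Ej : (inord j.+1 : 'I_n.+3) = j.+1 :> nat := inordK ltj.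
rewrite /F [fst _]/= [snd _]/= Ei Ej.
rewrite (@face_face _ (inord j.+1) (inord i) s i j) ?Ej ?Ei //.
by rewrite addSn exprS addnC mulN1r scaleNr.
Qed.

Definition cycles (n : nat) : {pred chain n} :=
  match n return {pred chain n} with
  | 0 => predT
  | m.+1 => kerl (@bd m)
  end.

Definition boundaries (n : nat) : {pred chain n} := iml (@bd n).

Fact cycles_submod n : submod_closed (@cycles n).
Proof. by case: n => [|n]; [split|exact: kerl_submod]. Qed.
HB.instance Definition _ n :=
  GRing.isSubmodClosed.Build A (chain n) (@cycles n) (cycles_submod n).

Fact boundaries_submod n : submod_closed (@boundaries n).
Proof. exact: iml_submod. Qed.
HB.instance Definition _ n :=
  GRing.isSubmodClosed.Build A (chain n) (@boundaries n) (boundaries_submod n).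

Lemma boundaries_cycles n : {subset @boundaries n <= @cycles n}.
Proof.
case: n => [|n] // f /imlP[g <-].
by apply/eqP; apply: bd_bd.
Qed.

Fact cycles_homogeneous n : homogeneous (chain_grading n) (@cycles n).
Proof. by case: n => [|n] //; apply: homogeneous_kerl (@bd_graded n). Qed.

Fact boundaries_homogeneous n : homogeneous (chain_grading n) (@boundaries n).
Proof. exact: homogeneous_iml (@bd_graded n). Qed.

Definition PH (n : nat) : gradedModule R kappa :=
  @GradedModule R kappa (quotmod (insubmod (@cycles n) (@boundaries n)))
    (quot_grading
      (@homogeneous_insubmod _ _ _ _ _ (@cycles_homogeneous n) _
        (@boundaries_homogeneous n))).

End Persistent.

Section Hamming.
Variables (R : realType) (k : nat).

Definition hamming (x y : k.-tuple bool) : nat :=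
  #|[set i | tnth x i != tnth y i]|.

Definition hamming_dist (x y : k.-tuple bool) : nnreal R :=
  nnreal_nat R (hamming x y).

Fact hamming_dist_eq0 x y : hamming_dist x y = nnreal0 R <-> x = y.
Proof.
split=> [/(congr1 (fun z : nnreal R => z%:num)) /eqP|->]; last first.
  apply: nnreal_inj => /=; rewrite /hamming.
  by under eq_finset do rewrite eqxx; rewrite cards0.
rewrite /= pnatr_eq0 cards_eq0 => /eqP xy; apply: eq_from_tnth => i.
by apply/eqP; move/setP: xy => /(_ i); rewrite !inE => /negbFE.
Qed.

Fact hamming_distC x y : hamming_dist x y = hamming_dist y x.
Proof.
apply: nnreal_inj => /=; congr (_%:R); rewrite /hamming.
by apply: eq_card => i; rewrite !inE eq_sym.
Qed.

Fact hamming_dist_triangle x y z :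
  (hamming_dist x z)%:num <= (hamming_dist x y)%:num + (hamming_dist y z)%:num.
Proof.
rewrite /= -natrD ler_nat.
apply: leq_trans (leq_card_setU _ _); apply: subset_leq_card.
apply/subsetP => i; rewrite !inE; case: (tnth x i =P tnth y i) => [->|] //.
Qed.

Definition hamming_cube : finMetricSpace R :=
  FinMetricSpace hamming_dist_eq0 hamming_distC hamming_dist_triangle.

End Hamming.

(* Main.v *)
From HB Require Import structures.
Require Import Defs.
From mathcomp Require Import all_boot all_order all_algebra.
From mathcomp Require Import boolp reals interval_inference zify ring monalg.

(** The degree-t part of the persistent chain complex of the cube is the complex
    of tuples whose entries are pairwise at Hamming distance at most r, the
    integer part of t, with coefficients in kappa. Over a field, a cycle of this
    finite complex is a boundary as soon as every cocycle vanishes on it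
    ([span_duality], [mono_boundaryP]); so everything reduces to a study
    of cocycles, which are plain functions of 2 or 3 vertices.

    Two-cocycles ([cocycle2_cobounds]), for every r. Such a cocycle may be taken
    skew-symmetric. If r <= 1, three points at mutual distance at most r are not
    distinct, and a skew function vanishes on them. If r >= 2, suppose f is
    already zero on triangles of diameter less than r. Then g(u,v) := - f(u,m,v),
    for any m strictly closer than r to both ends of a pair at distance r, is a
    primitive, because three distinct vertices at mutual distance at most r have a
    median which is closer than r to all of them. What must be checked is that g does not depend on m. For r >= 3
    this is automatic, since the possible m are connected to each other by short
    steps inside the interval from u to v. For r = 2 there are only two midpoints,
    and the difference is a function S on the squares of the cube, whose sum over
    the faces of each 3-cube is zero; such a function is the coboundary of a
    function on the edges, written explicitly as a sum of the squares between an
    edge and its projections towards the origin ([ladder]).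

    One-cocycles. The edges which join a vertex x <> 0 to the vertex obtained by
    clearing its highest bit form a spanning tree, and integrating a 1-cocycle
    along the tree gives a potential. If r >= 2 it is a primitive, because the
    cocycle has zero sum around squares ([cocycle1_potential]). If r = 1, the
    potential accounts for the tree edges only, and a 1-cycle pairs to zero with
    every cocycle as soon as, at each of the k 2^(k-1) - (2^k - 1) other edges, its
    coefficients on the two orientations agree ([tree_pairing]).

    The isomorphisms are then coordinate maps. In degree 0, a chain is sent to its
    coefficients at the nonzero vertices modulo T and to the sum of all its
    coefficients; in degree 1, a cycle is sent to its coefficients at the edges
    outside the tree (where opposite orientations count with opposite signs)
    modulo T. These maps kill boundaries; they are onto, the differences x - 0 and
    the fundamental cycles of the tree being dual to them; and by the above the
    cycles in their kernels are boundaries. *)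

Set Implicit Arguments.
Unset Strict Implicit.
Unset Printing Implicit Defensive.

Import Order.TTheory GRing.Theory Num.Theory.
Local Open Scope ring_scope.

(** * Finite sums and linear duality *)

Lemma sum_delta (B : nzRingType) (T : finType) (a : T) :
  \sum_b (b == a)%:R = 1 :> B.
Proof. by rewrite (bigD1 a) //= eqxx big1 ?addr0 // => b /negPf ->. Qed.

Lemma sum_mul_delta (B : nzRingType) (T : finType) (f : T -> B) (a : T) :
  \sum_b f b * (a == b)%:R = f a.
Proof.
rewrite (bigD1 a) //= eqxx mulr1 big1 ?addr0 // => b ba.
by rewrite eq_sym (negPf ba) mulr0.
Qed.

Lemma ffun_delta_sum (B : nzRingType) (T : finType) (f : {ffun T -> B^o}) :
  f = \sum_a (f a : B) *: ([ffun b => (b == a)%:R] : {ffun T -> B^o}).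
Proof.
apply/ffunP => b; rewrite sum_ffunE (bigD1 b) //= !ffunE eqxx.
rewrite -[_ *: _]/(_ * _ : B) mulr1 big1 ?addr0 // => a ab.
by rewrite !ffunE eq_sym (negPf ab) scaler0.
Qed.

Lemma sum_scale_sub (B : nzRingType) (M : lmodType B) (T : finType)
    (a : T -> B) (v : T -> M) (w : M) : \sum_i a i = 0 ->
  \sum_i a i *: v i = \sum_i a i *: (v i - w).
Proof.
move=> a0; under [RHS]eq_bigr do rewrite scalerBr.
by rewrite sumrB -scaler_suml a0 scale0r subr0.
Qed.

Lemma scale_triangle (B : nzRingType) (M : lmodType B) (a : B) (u v w : M) :
  a *: (v - u) + a *: (u - w) - a *: (v - w) = 0.
Proof. by rewrite -scalerDr -scalerBr addrA subrK subrr scaler0. Qed.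

Lemma interpolate_sum (B : nzRingType) (T : finType) m (e : 'I_m -> T) (o : T)
    (a : 'I_m -> B) (w : B) : injective e -> (forall j, e j != o) ->
  exists z : T -> B, (forall j, z (e j) = a j) /\ \sum_s z s = w.
Proof.
move=> e_inj eo.
exists (fun s => \sum_j a j * (s == e j)%:R + (w - \sum_j a j) * (s == o)%:R).
split=> [j|].
  rewrite (negPf (eo j)) mulr0 addr0 (bigD1 j) //= eqxx mulr1 big1 ?addr0 // => i ij.
  by rewrite (inj_eq e_inj) eq_sym (negPf ij) mulr0.
rewrite big_split /= exchange_big /= -mulr_sumr sum_delta mulr1 addrC -[RHS](subrK (\sum_j a j)).
by congr (_ + _); apply: eq_bigr => j _; rewrite -mulr_sumr sum_delta mulr1.
Qed.

Lemma dual_basis_sum (B : nzRingType) m (a p q : 'I_m -> B) j :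
  (forall i, p i - q i = (j == i)%:R) ->
  \sum_i a i * p i - \sum_i a i * q i = a j.
Proof.
move=> pq; rewrite -sumrB (bigD1 j) //= -mulrBr pq eqxx mulr1 big1 ?addr0 // => i ij.
by rewrite -mulrBr pq eq_sym (negPf ij) mulr0.
Qed.

Lemma sum_delta_diff (B : comNzRingType) (T : finType) (c : T -> T -> B) v :
  \sum_x \sum_y c x y * ((v == y)%:R - (v == x)%:R) = \sum_u (c u v - c v u).
Proof.
under eq_bigr do under eq_bigr do rewrite mulrBr.
under eq_bigr do rewrite sumrB sum_mul_delta -mulr_suml.
by rewrite sumrB sum_mul_delta -sumrB.
Qed.

Lemma sub_sign_delta (B : comNzRingType) n (b : 'I_n -> B) (c : B) (q q' : pred 'I_n) :
  (forall i, q i || q' i -> b i = c) ->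
  \sum_(i < n) (-1) ^+ i * (b i * (q i)%:R) - \sum_(i < n) (-1) ^+ i * (b i * (q' i)%:R)
    = c * \sum_(i < n) (-1) ^+ i * ((q i)%:R - (q' i)%:R).
Proof.
move=> bc; rewrite mulr_sumr -sumrB; apply: eq_bigr => i _.
have [/bc ->|/norP[/negPf -> /negPf ->]] := boolP (q i || q' i); last by ring.
by rewrite -mulrBr -mulrBr mulrCA.
Qed.

(** The terms at (u, v) and (v, u) cancel in pairs; grouping them by an order on
    [T], rather than writing the sum as its own opposite, covers characteristic 2. *)
Lemma sum_skew (K : zmodType) (T : finType) (F : T -> T -> K) :
  (forall u, F u u = 0) -> (forall u v, F v u = - F u v) -> \sum_u \sum_v F u v = 0.
Proof.
move=> F0 FN; pose lt (u v : T) := (enum_rank u < enum_rank v)%N.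
have split_lt u : \sum_v F u v = \sum_(v | lt u v) F u v + \sum_(v | lt v u) F u v.
  rewrite (bigID (lt u)) /=; congr (_ + _).
  rewrite (bigD1 u) ?/lt ?ltnn //= F0 add0r; apply: eq_bigl => v.
  by rewrite -leqNgt ltn_neqAle andbC (inj_eq val_inj) (inj_eq enum_rank_inj).
under eq_bigr do rewrite split_lt.
rewrite big_split /= [X in _ + X](exchange_big_dep xpredT) //= -big_split big1 //= => u _.
by rewrite -big_split big1 //= => v _; rewrite (FN u v) subrr.
Qed.

Lemma enum_set (T : finType) (B : {set T}) m : #|B| = m ->
  exists e : 'I_m -> T, injective e /\ forall x, x \in B <-> exists j, x = e j.
Proof.
move=> <-; exists enum_val; split=> [|x]; first exact: enum_val_inj.
split=> [xB|[j ->]]; last exact: enum_valP.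
by exists (enum_rank_in xB x); rewrite enum_rankK_in.
Qed.

(** The double annihilator theorem in finite dimension: the columns of the cokernel
    of the matrix of the rows [D s] are the functionals to test. *)
Lemma span_duality (K : fieldType) (S T : finType) (P : pred S)
    (D : S -> T -> K) (c : T -> K) :
  (forall f : T -> K, (forall s, P s -> \sum_t D s t * f t = 0) ->
     \sum_t c t * f t = 0) ->
  exists b : S -> K, (forall s, ~~ P s -> b s = 0) /\
    forall t, c t = \sum_s b s * D s t.
Proof.
move=> ann.
pose M := \matrix_(i < #|S|, j < #|T|) (D (enum_val i) (enum_val j) *+ P (enum_val i)).
pose v := \row_(j < #|T|) c (enum_val j).
have sumT (F : 'I_#|T| -> K) : \sum_j F j = \sum_t F (enum_rank t).
  by rewrite (reindex enum_rank) //; apply: onW_bij; apply: enum_rank_bij.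
have sumS (F : 'I_#|S| -> K) : \sum_j F j = \sum_t F (enum_rank t).
  by rewrite (reindex enum_rank) //; apply: onW_bij; apply: enum_rank_bij.
have /submxP[u vu] : (v <= M)%MS.
  rewrite submxE; apply/eqP/rowP => j; rewrite !mxE.
  rewrite sumT -[RHS](ann (fun t => cokermx M (enum_rank t) j)).
    by apply: eq_bigr => t _; rewrite mxE enum_rankK.
  move=> s Ps; have /matrixP /(_ (enum_rank s) j) := mulmx_coker M.
  rewrite mxE [RHS]mxE sumT => {2}<-; apply: eq_bigr => t _.
  by congr (_ * _); rewrite [RHS]mxE !enum_rankK Ps.
exists (fun s => u 0 (enum_rank s) *+ P s); split=> [s /negPf ->//|t].
have /rowP /(_ (enum_rank t)) := vu; rewrite !mxE enum_rankK sumS => ->.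
by apply: eq_bigr => s _; rewrite mxE !enum_rankK mulrnAl mulrnAr.
Qed.

(** * Graded modules *)

Section GradedIso.
Variables (R : realType) (kappa : fieldType).
Local Notation A := (polyR R kappa).

Lemma quotmod_eq0 (M : lmodType A) (S : submodClosed M) (x : M) :
  to_quotmod S x = 0 <-> x \in S.
Proof. by rewrite -(linear0 (to_quotmod S)) -[x in x \in S]subr0; apply: to_quotmod_eq. Qed.

Lemma homogeneous_sub (M : lmodType A) (G : grading M) (S : {pred M}) (B : submodClosed M) :
  homogeneous G S -> (forall t x, G t x -> x \in S -> x \in B) -> {subset S <= B}.
Proof.
move=> homS SB x xS; have [r [y [ur Gy xE]]] := homog_span G x.
rewrite xE in xS *; rewrite big_seq; apply: rpred_sum => t tr.
by apply: (SB t) => //; apply: (homS r y).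
Qed.

Lemma homogeneousI (M : lmodType A) (G : grading M) (S B : {pred M}) :
  homogeneous G S -> homogeneous G B -> homogeneous G [pred x | (x \in S) && (x \in B)].
Proof.
move=> homS homB r y ur Gy; rewrite inE => /andP[xS xB] t tr.
by rewrite inE (homS r y) ?(homB r y).
Qed.

(** Degrees are reflected because the images of the homogeneous components of
    [x] are the homogeneous components of [f x]. *)
Lemma graded_inj_homogE (M N : lmodType A) (G : grading M) (H : grading N)
    (f : {linear M -> N}) :
  injective f -> graded_map G H f -> forall t x, G t x <-> H t (f x).
Proof.
move=> fI fgr t x; split=> [|Hfx]; first exact: fgr.
have [r [y [ur Gy y0 xE]]] := homog_spanw G x.
have sub : {subset r <= undup (t :: r)} by move=> s sr; rewrite mem_undup inE sr orbT.
have := xE _ (undup_uniq _) sub => {xE} xE.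
pose z s := f (y s) - (if s == t then f x else 0).
have z0 : \sum_(s <- undup (t :: r)) z s = 0.
  rewrite sumrB -linear_sum -xE.
  rewrite [X in _ - X](bigD1_seq t) ?undup_uniq ?mem_undup ?inE ?eqxx //=.
  by rewrite big1 ?addr0 ?subrr // => s /negPf ->.
have Hz s : H s (z s).
  by apply: homogB; [exact: fgr|case: eqP => [->//|_]; exact: homog0].
have := homog_indep (undup_uniq _) Hz z0 (x := t).
rewrite mem_undup inE eqxx /z => /(_ isT) /eqP; rewrite eqxx subr_eq0 => /eqP /fI <-.
exact: Gy.
Qed.

Section FirstIso.
Variables (M N : lmodType A) (G : grading M) (H : grading N) (S : submodClosed M).
Hypothesis homS : homogeneous G S.
Variable phi : {linear M -> N}.
Hypotheses (phi_gr : graded_map G H phi) (phi_ker : forall x, phi x = 0 <-> x \in S).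
Hypothesis phi_surj : forall y, exists x, phi x = y.

Definition quot_lift (u : quotmod S) : N := phi (repr u).

Lemma quot_liftE x : quot_lift (to_quotmod S x) = phi x.
Proof.
apply/eqP; rewrite -subr_eq0 -linearB; apply/eqP/phi_ker.
by apply/to_quotmod_eq; rewrite to_quotmodK.
Qed.

Lemma quot_lift_linear : linear quot_lift.
Proof.
move=> a u v; rewrite -(to_quotmodK u) -(to_quotmodK v) -linearP !quot_liftE.
by rewrite linearP.
Qed.
HB.instance Definition _ :=
  GRing.isLinear.Build A (quotmod S) N *:%R quot_lift quot_lift_linear.

Lemma quot_lift_inj : injective quot_lift.
Proof.
move=> u v; rewrite -(to_quotmodK u) -(to_quotmodK v) !quot_liftE => uv.
by apply/to_quotmod_eq/phi_ker; rewrite linearB uv subrr.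
Qed.

Lemma quot_lift_graded : graded_map (quot_grading homS) H quot_lift.
Proof. by move=> t u [x Gx <-]; rewrite quot_liftE; apply: phi_gr. Qed.

Lemma graded_first_iso :
  graded_iso (GradedModule (quot_grading homS)) (GradedModule H).
Proof.
exists (quot_lift : {linear _ -> _}); split.
  have /choice[s sP] := phi_surj.
  exists (fun y => to_quotmod S (s y)) => [u|y]; last exact: etrans (quot_liftE _) (sP y).
  by apply: quot_lift_inj; rewrite quot_liftE sP.
exact: graded_inj_homogE quot_lift_inj quot_lift_graded.
Qed.

End FirstIso.
End GradedIso.

(** It is convenient to have [phi] defined on all chains: its vanishing on
    boundaries can then be checked on the generators. *)
Lemma PH_graded_iso (R : realType) (kappa : fieldType) (X : finMetricSpace R) n
    (N : gradedModule R kappa) (phi : {linear chain kappa X n -> N}) :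
  graded_map (chain_grading kappa X n) (gmod_grading N) phi ->
  (forall z, phi z = 0 -> z \in @cycles R kappa X n -> z \in @boundaries R kappa X n) ->
  (forall s : simplex X n.+1, phi (bd_gen kappa s) = 0) ->
  (forall y, exists2 z, z \in @cycles R kappa X n & phi z = y) ->
  graded_iso (PH kappa X n) N.
Proof.
case: N phi => N G phi phi_gr phi_ker phi_gen phi_surj.
have phi_bd z : z \in @boundaries R kappa X n -> phi z = 0.
  move=> /imlP[b <-]; rewrite /= /bd linear_sum big1 // => s _.
  by rewrite linearZ phi_gen /= scaler0.
apply: (@graded_first_iso R kappa _ N _ G _ _ (phi \o val)).
- by move=> t x; apply: phi_gr.
- move=> x; rewrite inE; split=> [x0|]; last exact: phi_bd.
  by apply: phi_ker; rewrite ?(valP x).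
- by move=> y; have [z zc zy] := phi_surj y; exists (Sub z zc).
Qed.

Lemma PH_eq0 (R : realType) (kappa : fieldType) (X : finMetricSpace R) n :
  {subset @cycles R kappa X n <= @boundaries R kappa X n} ->
  forall x : PH kappa X n, x = 0.
Proof.
move=> cyc_bd x; rewrite -(to_quotmodK x); apply/quotmod_eq0.
rewrite inE; apply: cyc_bd; exact: valP.
Qed.

(** * Homogeneous chains *)

Section Monomials.
Variables (R : realType) (kappa : fieldType).
Local Notation A := (polyR R kappa).
Local Notation N := (@nnreal_nat R).

Lemma nnrealBE (x y : nnreal R) : (x <= y)%O -> (nnrealB y x)%:num = y%:num - x%:num.
Proof. by move=> xy; rewrite /= max_l // subr_ge0. Qed.

Lemma nnreal_nat_le m n : (N m <= N n)%O = (m <= n)%N.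
Proof. exact: (ler_nat R m n). Qed.

Lemma nnrealBnat m n : (m <= n)%N -> nnrealB (N n) (N m) = N (n - m).
Proof.
by move=> mn; apply: nnreal_inj; rewrite nnrealBE ?nnreal_nat_le //= natrB.
Qed.

Lemma mul_swap_last (B : comNzRingType) (a b c e : B) : a * c = e -> a * b * c = e * b.
Proof. by move=> <-; rewrite mulrAC. Qed.

Lemma mul_sign_delta (B : comNzRingType) (a b : B) n (q : bool) :
  a * ((-1) ^+ n * (b * q%:R)) = if q then (-1) ^+ n * (a * b) else 0.
Proof. by case: q; rewrite ?mulr1 ?mulr0 // mulrCA. Qed.

Lemma monom_sign s (c : kappa) n :
  (-1) ^+ n * << c *g s >> = << c * (-1) ^+ n *g s >> :> A.
Proof.
rewrite -signr_odd -[in RHS]signr_odd; case: (odd n).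
  by rewrite expr1 mulN1r mulrN1 monalgUN.
by rewrite expr0 mul1r mulr1.
Qed.

Lemma monom_Tpow c s t : << c *g s >> * Tpow kappa t = << c *g nnrealD s t >> :> A.
Proof. by rewrite monomM (mulr1 c). Qed.

Lemma TpowD s t : Tpow kappa s * Tpow kappa t = Tpow kappa (nnrealD s t) :> A.
Proof. exact: monom_Tpow. Qed.

Lemma monom_face c s t u n (q : bool) : (q -> nnrealD s t = u) ->
  << c *g s >> * ((-1) ^+ n * (Tpow kappa t * q%:R))
    = << c * ((-1) ^+ n * q%:R) *g u >> :> A.
Proof.
move=> stu; rewrite mul_sign_delta; case: q stu => [<- //|_].
  by rewrite monom_Tpow monom_sign (mulr1 ((-1) ^+ n : kappa)).
by rewrite (mulr0 ((-1) ^+ n : kappa)) (mulr0 c) monalgU0.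
Qed.

Lemma mcoeff_mulT (y : A) (s u : nnreal R) : (u < s)%O -> mcoeff u (y * Tpow kappa s) = 0.
Proof.
move=> us; rewrite (monalgE y) mulr_suml raddf_sum big1 //= => v _.
rewrite monomM mcoeffU; case: eqP => // vu; move: us; rewrite -vu.
by rewrite -[(_ < s)%O]/(v%:num + s%:num < s%:num) ltNge lerDr ge0.
Qed.

Lemma mcoeff_subU (a b : kappa) (s : nnreal R) :
  mcoeff s (<< a *g s >> - << b *g s >>) = a - b.
Proof.
transitivity (mcoeff s << a *g s >> - mcoeff s << b *g s >>); first exact: mcoeffB.
by congr (_ - _); exact: mcoeffUU.
Qed.

Lemma Tpow_ideal s t (a : A) : (s <= t)%O -> Tpow kappa t * a \in @Tideal R kappa s.
Proof.
move=> st; apply/TidealP; exists (Tpow kappa (nnrealB t s) * a).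
by apply/esym/mul_swap_last; rewrite TpowD nnrealDC nnrealBKC.
Qed.

Section Chains.
Variable X : finMetricSpace R.
Implicit Type n : nat.

(** The homogeneous chain of degree [t] with coefficients [c], for [c] supported
    on the simplices of diameter at most [t]; the differential of such chains is
    the ordinary one, [coef_bd], on coefficients. *)
Definition mono n (t : nnreal R) (c : simplex X n -> kappa) : chain kappa X n :=
  [ffun s => << c s *g nnrealB t (diam s) >>].

Definition coef_bd n (c : simplex X n.+1 -> kappa) (s' : simplex X n) : kappa :=
  \sum_s c s * \sum_(i < n.+2) (-1) ^+ i * (s' == face i s)%:R.

Lemma mono_eq0 n t c s : mono (n := n) t c = 0 -> c s = 0.
Proof.
by move/ffunP/(_ s)/eqP; rewrite !ffunE monalgU_eq0 => /eqP.
Qed.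

Lemma homog_mono n t z : chain_grading kappa X n t z ->
  exists c, (forall s, ~~ (diam s <= t)%O -> c s = 0) /\ z = mono t c.
Proof.
move=> Gz.
have /choice[c cP] : forall s, exists c : kappa, (~~ (diam s <= t)%O -> c = 0) /\
    z s = << c *g nnrealB t (diam s) >>.
  move=> s; have [st|st] := boolP (diam s <= t)%O.
    have /(shift_homogP _ _ st)[c zc] := Gz s; by exists c.
  case: (Gz s) => [->|[u tu _]]; first by exists 0; rewrite monalgU0.
  case/negP: st; rewrite tu -[(_ <= _)%O]/((diam s)%:num <= (diam s)%:num + u%:num).
  by rewrite lerDl.
exists c; split=> [s|]; first by have [] := cP s.
by apply/ffunP => s; rewrite ffunE; have [] := cP s.
Qed.

Lemma bd_gen_val n (s : simplex X n.+1) (s' : simplex X n) :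
  bd_gen kappa s s' = \sum_(i < n.+2) (-1) ^+ i *
    (Tpow kappa (nnrealB (diam s) (diam (face i s))) * (s' == face i s)%:R) :> A.
Proof. by rewrite /bd_gen sum_ffunE; apply: eq_bigr => i _; rewrite !ffunE. Qed.

(** The power of T that [c] carries at a simplex and the power that [bd] puts on
    its face add up to the power expected at the face. *)
Lemma bd_mono n t (c : simplex X n.+1 -> kappa) :
  (forall s, ~~ (diam s <= t)%O -> c s = 0) -> bd (mono t c) = mono t (coef_bd c).
Proof.
move=> c_supp; apply/ffunP => s'; rewrite /bd sum_ffunE !ffunE raddf_sum.
apply: eq_bigr => s _; rewrite !ffunE /bd_gen sum_ffunE.
rewrite -[LHS]/(_ * _ : A).
rewrite /=; have [st|st] := boolP (diam s <= t)%O; last first.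
  by rewrite c_supp // mul0r !raddf0 mul0r.
rewrite mulr_sumr mulr_sumr raddf_sum; apply: eq_bigr => i _.
rewrite !ffunE -[((-1) ^+ i *: _)]/((-1) ^+ i * (Tpow kappa _ * (s' == face i s)%:R) : A).
apply: monom_face => /eqP ->.
have fs := diam_face i s.
by apply: nnreal_inj; rewrite nnrealDE !nnrealBE ?(le_trans fs) // subrKA.
Qed.

Lemma sum_face_delta n (f : simplex X n -> kappa) (s : simplex X n.+1) :
  \sum_s' (\sum_(i < n.+2) (-1) ^+ i * (s' == face i s)%:R) * f s'
    = \sum_(i < n.+2) (-1) ^+ i * f (face i s).
Proof.
under eq_bigr do rewrite mulr_suml.
rewrite exchange_big; apply: eq_bigr => i _ /=.
under eq_bigr do rewrite -mulrA.
rewrite -mulr_sumr; congr (_ * _); rewrite -[RHS]sum_mul_delta.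
by apply: eq_bigr => s' _; rewrite mulrC eq_sym.
Qed.

Lemma sum_face n (f : simplex X n -> kappa) (c : simplex X n.+1 -> kappa) :
  \sum_s c s * \sum_(i < n.+2) (-1) ^+ i * f (face i s) = \sum_s' coef_bd c s' * f s'.
Proof.
under [RHS]eq_bigr do rewrite mulr_suml.
rewrite [RHS]exchange_big; apply: eq_bigr => s _ /=.
under [RHS]eq_bigr do rewrite -mulrA.
by rewrite -mulr_sumr sum_face_delta.
Qed.

(** The simplices of diameter at most [t] span the degree-[t] chains, so this is
    [span_duality] for the matrix of face signs. *)
Lemma mono_boundaryP n t (c : simplex X n -> kappa) :
  (forall s, ~~ (diam s <= t)%O -> c s = 0) ->
  (forall f : simplex X n -> kappa,
     (forall s : simplex X n.+1, (diam s <= t)%O ->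
        \sum_(i < n.+2) (-1) ^+ i * f (face i s) = 0) ->
     \sum_s c s * f s = 0) ->
  mono t c \in @boundaries R kappa X n.
Proof.
move=> c_supp ann.
have [|b [b_supp cE]] := @span_duality kappa (simplex X n.+1) (simplex X n)
  (fun s => (diam s <= t)%O)
  (fun s s' => \sum_(i < n.+2) (-1) ^+ i * (s' == face i s)%:R) c.
  by move=> f fP; apply: ann => s st; rewrite -sum_face_delta; apply: fP.
apply/imlP; exists (mono t b); apply: etrans (bd_mono b_supp) _.
by congr mono; apply/funext => s'; rewrite cE.
Qed.

Lemma pairing_cobd n t (c f : simplex X n.+1 -> kappa) (g : simplex X n -> kappa) :
  (forall s, ~~ (diam s <= t)%O -> c s = 0) -> bd (mono t c) = 0 ->
  (forall s, (diam s <= t)%O -> f s = \sum_(i < n.+2) (-1) ^+ i * g (face i s)) ->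
  \sum_s c s * f s = 0.
Proof.
move=> c_supp bc fg.
transitivity (\sum_s c s * \sum_(i < n.+2) (-1) ^+ i * g (face i s)).
  apply: eq_bigr => s _; have [st|st] := boolP (diam s <= t)%O; first by rewrite fg.
  by rewrite c_supp // !mul0r.
rewrite sum_face big1 // => s _; rewrite (@mono_eq0 _ t) ?mul0r //.
by rewrite -bd_mono.
Qed.

End Chains.
End Monomials.

(** * The Hamming metric *)

Section Cube.
Variable k : nat.
Local Notation V := (k.-tuple bool).
Local Notation d := (@hamming k).
Implicit Types (x y z u v : V) (i j l : 'I_k).
Local Open Scope nat_scope.

Lemma hamming_sum x y : hamming x y = \sum_(i < k) (tnth x i != tnth y i).
Proof. by rewrite /hamming -sum1dep_card big_mkcond. Qed.

Lemma hammingC x y : hamming x y = hamming y x.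
Proof. by rewrite !hamming_sum; apply: eq_bigr => i _; rewrite eq_sym. Qed.

Lemma hammingxx x : hamming x x = 0.
Proof. by rewrite hamming_sum big1 // => i _; rewrite eqxx. Qed.

Lemma hamming_eq0 x y : (hamming x y == 0) = (x == y).
Proof.
apply/eqP/eqP => [|->]; last exact: hammingxx.
move/cards0_eq/setP => xy; apply: eq_from_tnth => i.
by apply/eqP; have := xy i; rewrite !inE => /negbFE.
Qed.

Lemma hamming_triangle y x z : hamming x z <= hamming x y + hamming y z.
Proof.
rewrite !hamming_sum -big_split /=; apply: leq_sum => i _.
by case: (tnth x i) (tnth y i) (tnth z i) => -[] [].
Qed.

Lemma hamming_gt0P x y : 0 < hamming x y -> exists i, tnth x i != tnth y i.
Proof. by move/card_gt0P => [i]; rewrite inE => ?; exists i. Qed.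

Definition flip x i : V := [tuple tnth x j (+) (j == i) | j < k].

Lemma tnth_flip x i j : tnth (flip x i) j = tnth x j (+) (j == i).
Proof. exact: tnth_mktuple. Qed.

Lemma flipK i : involutive (flip^~ i).
Proof. by move=> x; apply: eq_from_tnth => j; rewrite !tnth_flip addbK. Qed.

Lemma flipC x i j : flip (flip x i) j = flip (flip x j) i.
Proof. by apply: eq_from_tnth => l; rewrite !tnth_flip addbAC. Qed.

Lemma flip_inj x : injective (flip x).
Proof.
move=> i j /(congr1 (fun y : V => tnth y i)).
by rewrite !tnth_flip => /addbI; rewrite eqxx => /esym /eqP.
Qed.

Lemma flip_eq x y i : (y == flip x i) = (x == flip y i).
Proof. by apply/eqP/eqP => ->; rewrite flipK. Qed.

Lemma hamming_flip x i : hamming x (flip x i) = 1.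
Proof.
rewrite hamming_sum (bigD1 i) //= tnth_flip eqxx big1 ?addn0; first by case: (tnth x i).
by move=> j /negPf ji; rewrite tnth_flip ji addbF eqxx.
Qed.

Lemma flip_neq x i : (x == flip x i) = false.
Proof. by rewrite -hamming_eq0 hamming_flip. Qed.

Lemma hamming_flipr x y i : tnth x i != tnth y i -> hamming (flip x i) y = (hamming x y).-1.
Proof.
move=> xy; rewrite !hamming_sum (bigD1 i) //= [in RHS](bigD1 i) //= xy add1n /=.
rewrite tnth_flip eqxx addbT; case: (tnth x i) (tnth y i) xy => -[] //= _;
  by apply: eq_bigr => j /negPf ji; rewrite tnth_flip ji addbF.
Qed.

Lemma hamming_le2 u i j : (d u (flip (flip u i) j) <= 2)%N.
Proof. by have := hamming_triangle (flip u i) u (flip (flip u i) j); rewrite !hamming_flip. Qed.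

Lemma hamming_flips_le2 u i j : (d (flip u i) (flip u j) <= 2)%N.
Proof.
have := hamming_triangle u (flip u i) (flip u j).
by rewrite (hammingC (flip u i) u) !hamming_flip.
Qed.

Lemma hamming1P u v : d u v = 1%N -> exists i, v = flip u i.
Proof.
move=> uv; have [|i uvi] := @hamming_gt0P u v; first by rewrite uv.
exists i; apply/eqP; rewrite eq_sym -hamming_eq0 hamming_flipr // uv //.
Qed.

Lemma step_towards x y : (0 < d x y)%N ->
  exists m, d x m = 1%N /\ (d m y).+1 = d x y.
Proof.
move=> xy; have [i xyi] := hamming_gt0P xy.
exists (flip x i); rewrite hamming_flip hamming_flipr //; split=> //; lia.
Qed.

Definition median x y z : V :=
  [tuple if tnth x i == tnth y i then tnth x i else tnth z i | i < k].

(** The median lies on a geodesic between any two of the three points, as can be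
    read off one coordinate at a time. *)
Lemma hamming_median x y z :
  [/\ hamming (median x y z) x + hamming (median x y z) y = hamming x y,
      hamming (median x y z) y + hamming (median x y z) z = hamming y z
    & hamming (median x y z) x + hamming (median x y z) z = hamming x z].
Proof.
rewrite !hamming_sum; split; rewrite -big_split; apply: eq_bigr => i _;
  by rewrite tnth_mktuple; case: (tnth x i) (tnth y i) (tnth z i) => -[] [].
Qed.

(** The vertices [truncate n x], for n from 0 to k, form a path from the origin to
    [x] that sets the bits of [x] in increasing order. *)
Definition truncate (n : nat) x : V := [tuple tnth x i && (i < n) | i < k].

Definition origin : V := [tuple false | _ < k].

Lemma tnth_origin i : tnth origin i = false.
Proof. exact: tnth_mktuple. Qed.

Lemma truncate_id x : truncate k x = x.
Proof. by apply: eq_from_tnth => i; rewrite tnth_mktuple ltn_ord andbT. Qed.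

Lemma truncate0 x : truncate 0 x = origin.
Proof.
by apply: eq_from_tnth => i; rewrite tnth_origin tnth_mktuple andbF.
Qed.

Lemma truncateS x l :
  truncate l.+1 x = if tnth x l then flip (truncate l x) l else truncate l x.
Proof.
apply: eq_from_tnth => i; case: ifP => xl; rewrite ?tnth_flip !tnth_mktuple ltnS leq_eqVlt.
  rewrite val_eqE; have [->|_] := eqVneq i l; first by rewrite xl ltnn.
  by rewrite addbF.
by rewrite val_eqE; have [->|_] := eqVneq i l; rewrite ?xl ?ltnn.
Qed.

Lemma truncate_flip x n i :
  truncate n (flip x i) = if i < n then flip (truncate n x) i else truncate n x.
Proof.
apply: eq_from_tnth => j; case: ifP => i_n; rewrite ?tnth_flip !tnth_mktuple ?tnth_flip.
  by have [->|_] := eqVneq j i; rewrite ?i_n ?addbF // !andbT.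
by have [->|_] := eqVneq j i; rewrite ?i_n ?andbF ?addbF.
Qed.

End Cube.

(** * A spanning tree of the cube *)

Section SpanningTree.
Variable k : nat.
Local Notation V := (k.-tuple bool).
Implicit Types (x y : V) (i l : 'I_k).

(** The edge from [x] to [flip x i] is in the tree when [i] is the highest bit of
    [flip x i]: each vertex other than the origin hangs from the vertex obtained
    by clearing its highest bit. *)
Definition tree_edge x i := [forall l : 'I_k, (i <= l)%N ==> ~~ tnth x l].

Lemma tree_edgeN (x : V) i : tree_edge x i -> ~~ tnth x i.
Proof. by move=> /forallP /(_ i); rewrite leqnn. Qed.

Lemma tree_edge_truncate x (l : 'I_k) : tree_edge (truncate l x) l.
Proof.
by apply/forallP => i; rewrite tnth_mktuple; apply/implyP => li; rewrite ltnNge li andbF.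
Qed.

(** Edges are listed once, from their lower end. *)
Definition extra_edges : {set V * 'I_k} :=
  [set e | ~~ tnth e.1 e.2 & ~~ tree_edge e.1 e.2].

(** Flipping exchanges the two ends of the edges, so half of the pairs (vertex,
    direction) start at the lower end. *)
Lemma card_upward : (1 <= k)%N ->
  #|[set e : V * 'I_k | ~~ tnth e.1 e.2]| = (k * 2 ^ (k - 1))%N.
Proof.
move=> k1; set U := [set e | _].
pose h (e : V * 'I_k) := (flip e.1 e.2, e.2).
have hI : injective h by apply: (can_inj (g := h)) => -[x i]; rewrite /h /= flipK.
have Uc : #|~: U| = #|U|.
  rewrite -[RHS](card_imset _ hI); apply: eq_card => -[x i]; rewrite in_setC inE negbK.
  apply/idP/imsetP => [xi|[[y j]]]; last first.
    by rewrite inE /= => yj [-> ->]; rewrite tnth_flip eqxx addbT.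
  exists (flip x i, i); rewrite ?inE /= ?tnth_flip ?eqxx ?addbT ?xi //.
  by rewrite /h /= flipK.
have := cardsC U; rewrite Uc card_prod card_tuple card_bool card_ord.
have -> : (2 ^ k = 2 * 2 ^ (k - 1))%N by rewrite -expnS subn1 prednK.
nia.
Qed.

(** Taking the upper end is a bijection from the tree edges to the vertices other
    than the origin. *)
Lemma card_tree_edges : #|[set e : V * 'I_k | tree_edge e.1 e.2]| = (2 ^ k - 1)%N.
Proof.
set E := [set e | _].
have <- : #|[set~ (origin k)]| = (2 ^ k - 1)%N.
  have := cardsC1 (origin k); rewrite card_tuple card_bool; lia.
rewrite -(@card_in_imset _ _ (fun e : V * 'I_k => flip e.1 e.2) E).
  apply: eq_card => y; rewrite in_setC1; apply/imsetP/idP => [[[x i]]|y0].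
    rewrite inE /= => /tree_edgeN xi ->; apply/eqP => /(congr1 (fun z : V => tnth z i)).
    by rewrite tnth_origin tnth_flip eqxx addbT (negPf xi).
  have [i0 yi0] : exists i, tnth y i.
    apply/existsP; apply: contraR y0; rewrite negb_exists => /forallP yF.
    by apply/eqP/eq_from_tnth => i; rewrite tnth_origin (negPf (yF i)).
  have [i yi imax] := @arg_maxnP _ i0 (fun i => tnth y i) (fun i => i : nat) yi0.
  exists (flip y i, i); rewrite ?flipK //= inE; apply/forallP => l.
  apply/implyP => il; rewrite tnth_flip; have [->|li] := eqVneq l i.
    by rewrite yi.
  rewrite addbF; apply: contra_neqN li => /imax li.
  by apply/eqP; rewrite -val_eqE /= eqn_leq il andbT.
have aux (x x' : V) (i i' : 'I_k) : tree_edge x i -> tree_edge x' i' ->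
    flip x i = flip x' i' -> ~~ (i < i')%N.
  move=> /forallP te /tree_edgeN x'i' e; apply/negP => ii'.
  have := congr1 (fun z : V => tnth z i') e; rewrite !tnth_flip eqxx (negPf x'i').
  have /negPf -> : i' != i by rewrite -val_eqE neq_ltn ii' orbT.
  by have := te i'; rewrite (ltnW ii') addbF => /negPf ->.
move=> [x i] [x' i']; rewrite !inE /= => xi x'i' e.
have ii' : i = i'.
  apply: val_inj => /=; have := aux _ _ _ _ xi x'i' e; have := aux _ _ _ _ x'i' xi (esym e).
  lia.
by rewrite -ii' in e *; rewrite -[x](flipK i) e flipK.
Qed.

Lemma card_extra_edges : (1 <= k)%N ->
  #|extra_edges| = (k * 2 ^ (k - 1) - (2 ^ k - 1))%N.
Proof.
move=> k1; rewrite -card_upward // -card_tree_edges -cardsDS.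
  by apply: eq_card => e; rewrite !inE andbC.
by apply/subsetP => e; rewrite !inE => /tree_edgeN.
Qed.

End SpanningTree.

(** * Two-cocycles on the cube *)

Section Cohomology2.
Variables (k : nat) (K : comNzRingType).
Local Notation V := (k.-tuple bool).
Local Notation d := (@hamming k).
Implicit Types (x y z u v w : V) (i j l : 'I_k) (r : nat).
Implicit Types (g : V -> V -> K) (f : V -> V -> V -> K).

Definition cobd g x y z := g y z - g x z + g x y.

Definition cocycle2 r f := forall x y z w,
  (d x y <= r)%N -> (d x z <= r)%N -> (d x w <= r)%N ->
  (d y z <= r)%N -> (d y w <= r)%N -> (d z w <= r)%N ->
  f y z w - f x z w + f x y w - f x y z = 0.

Definition cobounds2 r f g := forall x y z,
  (d x y <= r)%N -> (d x z <= r)%N -> (d y z <= r)%N -> f x y z = cobd g x y z.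

Definition skew2 g := (forall x, g x x = 0) /\ (forall x y, g y x = - g x y).

Definition skew3 f := [/\ forall x y, f x x y = 0,
  forall x y z, f y x z = - f x y z & forall x y z, f x z y = - f x y z].

Lemma skew3_cobd g : skew2 g -> skew3 (cobd g).
Proof.
move=> [g0 gN]; split=> [x y|x y z|x y z]; rewrite /cobd ?g0 ?(gN x y) ?(gN y z); ring.
Qed.

Lemma skew3_sub f f' : skew3 f -> skew3 f' -> skew3 (fun x y z => f x y z - f' x y z).
Proof.
move=> [f0 fl fr] [f0' fl' fr']; split=> [x y|x y z|x y z].
- by rewrite f0 f0' subr0.
- by rewrite fl fl' opprB opprK addrC.
- by rewrite fr fr' opprB opprK addrC.
Qed.

Lemma skew2D g g' : skew2 g -> skew2 g' -> skew2 (fun x y => g x y + g' x y).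
Proof.
move=> [g0 gN] [g0' gN']; split=> [x|x y]; first by rewrite g0 g0' addr0.
by rewrite gN gN' opprD.
Qed.

Lemma cocycle2_sub_cobd r f g :
  cocycle2 r f -> cocycle2 r (fun x y z => f x y z - cobd g x y z).
Proof.
move=> cf x y z w xy xz xw yz yw zw; rewrite -[RHS](cf x y z w) // /cobd; ring.
Qed.

Lemma cobounds2_add r f g g' :
  cobounds2 r (fun x y z => f x y z - cobd g x y z) g' ->
  cobounds2 r f (fun x y => g x y + g' x y).
Proof.
move=> H x y z xy xz yz; have := H x y z xy xz yz.
by move/eqP; rewrite subr_eq => /eqP ->; rewrite /cobd; ring.
Qed.

Lemma skew3_eq f : skew3 f -> (forall x y, f x y y = 0) /\ (forall x y, f x y x = 0).
Proof.
move=> [f0 fl fr]; have f1 x y : f x y x = 0 by rewrite fr f0 oppr0.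
by split=> // x y; rewrite fl f1 oppr0.
Qed.

(** Three points at mutual distance at most 1 cannot be distinct: their distances
    to the median would be integers with pairwise sums equal to 1. *)
Lemma skew3_eq0_small r f x y z : skew3 f -> (r <= 1)%N ->
  (d x y <= r)%N -> (d x z <= r)%N -> (d y z <= r)%N -> f x y z = 0.
Proof.
move=> af r1 xy xz yz; have [f0 _ _] := af; have [f1 f2] := skew3_eq af.
have [h1 h2 h3] := hamming_median x y z.
have [->|xNy] := eqVneq x y; first exact: f0.
have [->|xNz] := eqVneq x z; first exact: f2.
have [->|yNz] := eqVneq y z; first exact: f1.
move: xNy xNz yNz; rewrite -!hamming_eq0; lia.
Qed.

(** The alternating cochains compute the same cohomology as all cochains. The
    primitive [g] is forced on the diagonal by f(x,x,x); the cocycle condition then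
    forces g(x,y) + g(y,x), and an arbitrary order on the vertices decides which of
    the two values is zero. Outside the simplices of diameter at most [r], [f'] is
    set to zero so that its skew symmetry holds without side conditions. *)
Lemma cocycle2_skew r f : cocycle2 r f -> exists f' g, [/\ skew3 f', cocycle2 r f' &
  forall x y z, (d x y <= r)%N -> (d x z <= r)%N -> (d y z <= r)%N ->
    f x y z = f' x y z + cobd g x y z].
Proof.
move=> cf.
pose lt x y := (enum_rank x < enum_rank y)%N.
pose g x y := if x == y then f x x x else if lt x y then 0 else f y x y + f y y y.
pose E x y := (d x y <= r)%N.
pose f' x y z := if [&& E x y, E x z & E y z] then f x y z - cobd g x y z else 0.
have Exx x : E x x by rewrite /E hammingxx.
have EC x y : E x y = E y x by rewrite /E hammingC.
have f'E x y z : E x y -> E x z -> E y z -> f' x y z = f x y z - cobd g x y z.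
  by rewrite /f' => -> -> ->.
have C x y z w : E x y -> E x z -> E x w -> E y z -> E y w -> E z w ->
    f y z w - f x z w + f x y w - f x y z = 0 by apply: cf.
have fxxy x y : E x y -> f x x y = f x x x.
  by move=> xy; apply/eqP; rewrite -subr_eq0 -[X in _ == X](C x x x y) //; apply/eqP; ring.
have fxyy x y : E x y -> f x y y = f y y y.
  by move=> xy; apply/eqP; rewrite eq_sym -subr_eq0 -[X in _ == X](C x y y y) //; apply/eqP; ring.
have gxx x : g x x = f x x x by rewrite /g eqxx.
have gg x y : E x y -> x != y -> g x y + g y x = f x y x + f x x x.
  move=> xy xNy.
  have fyxy : f y x y = f x y x + f x x x - f y y y.
    have := C x y x y xy (Exx x) xy (etrans (EC y x) xy) (Exx y) xy.
    rewrite fxxy // fxyy // => H; apply/eqP; rewrite -subr_eq0 -[X in _ == X]H.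
    by apply/eqP; ring.
  rewrite /g (eq_sym y x) (negPf xNy) /lt.
  case: ltngtP => [_|_|/val_inj/enum_rank_inj e]; last by rewrite e eqxx in xNy.
    by rewrite add0r.
  by rewrite addr0 fyxy subrK.
have z0 x y : f' x x y = 0.
  rewrite /f'; case: and3P => // -[_ xy _].
  by rewrite fxxy // /cobd gxx; ring.
have z1 x y : f' x y y = 0.
  rewrite /f'; case: and3P => // -[xy _ _].
  by rewrite fxyy // /cobd gxx; ring.
have z2 x y : f' x y x = 0.
  have [->|xNy] := eqVneq x y; first exact: z0.
  rewrite /f'; case: and3P => // -[xy _ _].
  rewrite /cobd gxx -[f x y x](addrK (f x x x)) -gg //; ring.
have cf' : cocycle2 r f'.
  move=> x y z w *; rewrite !f'E //; exact: (@cocycle2_sub_cobd r f g).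
have out x y z : ~~ [&& E x y, E x z & E y z] -> f' x y z = 0.
  by rewrite /f' => /negPf ->.
exists f', g; split=> //; last by move=> x y z xy xz yz; rewrite f'E // subrK.
split=> // x y z.
  have [/and3P[xy xz yz]|no] := boolP [&& E x y, E x z & E y z]; last first.
    rewrite (out x) // (out y) ?oppr0 //.
    by move: no; rewrite (EC y x); case: (E x y) (E x z) (E y z) => -[] [].
  have := cf' x y x z xy (Exx x) xz; rewrite hammingC => /(_ xy yz xz).
  by rewrite z2 z0 subr0 subr0 => /eqP; rewrite addr_eq0 => /eqP.
have [/and3P[xy xz yz]|no] := boolP [&& E x y, E x z & E y z]; last first.
  rewrite (out x y) // (out x) ?oppr0 //.
  by move: no; rewrite (EC z y); case: (E x y) (E x z) (E y z) => -[] [].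
have := cf' x y z y xy xz xy yz (Exx y); rewrite hammingC => /(_ yz).
by rewrite z1 z2 addr0 sub0r -opprD => /eqP; rewrite oppr_eq0 addr_eq0 => /eqP.
Qed.

(** The cocycle condition on a triangle together with its median expresses [f]
    through triangles with at most one side of length [r], and the value of [f] on
    these is determined by that side because the midpoint does not matter. *)
Lemma cobounds2_step r f : (1 < r)%N -> skew3 f -> cocycle2 r f ->
  (forall x y z, (d x y < r)%N -> (d x z < r)%N -> (d y z < r)%N -> f x y z = 0) ->
  (forall u v m m', d u v = r -> (d u m < r)%N -> (d m v < r)%N ->
     (d u m' < r)%N -> (d m' v < r)%N -> f u m v = f u m' v) ->
  exists g, skew2 g /\ cobounds2 r f g.
Proof.
move=> r1 af cf f_lt f_ind; have [f0 fl fr] := af; have [f1 f2] := skew3_eq af.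
have midP u v : d u v = r -> exists m, (d u m < r)%N && (d m v < r)%N.
  move=> uv; have [|m [um mv]] := @step_towards _ u v; first by lia.
  by exists m; lia.
pose mid u v := odflt u [pick m | (d u m < r)%N && (d m v < r)%N].
have midE u v : d u v = r -> (d u (mid u v) < r)%N /\ (d (mid u v) v < r)%N.
  move=> uv; rewrite /mid; case: pickP => [m /andP //|no].
  by have [m] := midP _ _ uv; rewrite no.
pose g u v := if d u v == r then - f u (mid u v) v else 0.
have gE q a b : (d q a < r)%N -> (d q b < r)%N -> (d a b <= r)%N -> f q a b = g a b.
  move=> qa qb ab; rewrite /g; case: eqP => [abr|ne]; last by apply: f_lt => //; lia.
  have [h1 h2] := midE _ _ abr.
  by rewrite (f_ind _ _ _ q abr h1 h2) ?(hammingC a q) // fl opprK.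
have gN x y : g y x = - g x y.
  rewrite /g hammingC; case: eqP => [xy|_]; last by rewrite oppr0.
  have [h1 h2] := midE _ _ xy.
  have [h3 h4] : _ /\ _ := midE y x (etrans (hammingC _ _) xy).
  rewrite (f_ind _ _ _ (mid y x) xy h1 h2) ?(hammingC x) ?(hammingC _ y) //.
  set m := mid y x.
  by rewrite opprK (fl m y x) fr (fl x m y) !opprK.
have g0 x : g x x = 0 by rewrite /g hammingxx; case: eqP => // ?; lia.
exists g; split=> // x y z xy xz yz; rewrite /cobd.
have [->|xNy] := eqVneq x y; first by rewrite f0 g0 subrr addr0.
have [->|xNz] := eqVneq x z; first by rewrite f2 g0 gN subr0 addNr.
have [->|yNz] := eqVneq y z; first by rewrite f1 g0 add0r addNr.
have [h1 h2 h3] := hamming_median x y z; set q := median x y z in h1 h2 h3.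
have [qx qy qz] : [/\ d q x < r, d q y < r & d q z < r]%N.
  by move: xNy xNz yNz; rewrite -!hamming_eq0; split; lia.
rewrite -(gE q y z) // -(gE q x z) // -(gE q x y) //.
have cq : f x y z - f q y z + f q x z - f q x y = 0 by apply: cf => //; lia.
by rewrite -[LHS]subr0 -cq; ring.
Qed.

(** For distance 2, independence of the midpoint is the vanishing of this
    function of squares: [u] and [flip (flip u i) j] are opposite corners, and the
    midpoints are [flip u i] and [flip u j]. *)
Definition square f u i j :=
  f u (flip u i) (flip (flip u i) j) - f u (flip u j) (flip (flip u i) j).

Section Square.
Variable f : V -> V -> V -> K.
Hypotheses (af : skew3 f) (cf : cocycle2 2 f).
Local Notation S := (square f).

Lemma squareC u i j : S u j i = - S u i j.
Proof. by rewrite /square flipC opprB. Qed.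

(** Changing the base point reverses the orientation of the square: the four
    corners are at mutual distance at most 2, and the cocycle condition on them
    relates the two diagonals. *)
Lemma square_flipl u i j : S (flip u i) i j = - S u i j.
Proof.
have [f0 fl fr] := af.
have H : f (flip u i) (flip (flip u i) j) (flip u j) - f u (flip (flip u i) j) (flip u j)
   + f u (flip u i) (flip u j) - f u (flip u i) (flip (flip u i) j) = 0.
  apply: cf; rewrite ?hamming_flip ?hamming_flips_le2 ?hamming_le2 //.
  by rewrite flipC hammingC hamming_flip.
rewrite /square flipK (fl u (flip u i)).
rewrite (fr u (flip u j)) in H *; apply/eqP; rewrite -subr_eq0 -oppr_eq0 -[X in _ == X]H.
by apply/eqP; ring.
Qed.

Lemma square_flipr u i j : S (flip u j) i j = - S u i j.
Proof. by rewrite squareC square_flipl squareC opprK. Qed.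

(** In a 3-cube, [a], [b], [c], [e] are the corners of one parity, which are at
    mutual distance 2; each face of that tetrahedron is coned off to the corner of
    the other parity adjacent to its three vertices. Every square of the cube
    contains one edge of the tetrahedron and two of the apexes. *)
Lemma tetrahedron_cocycle a b c e p q s o :
    (d a b <= 2)%N -> (d a c <= 2)%N -> (d a e <= 2)%N ->
    (d b c <= 2)%N -> (d b e <= 2)%N -> (d c e <= 2)%N ->
    (d p a <= 2)%N -> (d p b <= 2)%N -> (d p c <= 2)%N ->
    (d q a <= 2)%N -> (d q b <= 2)%N -> (d q e <= 2)%N ->
    (d s a <= 2)%N -> (d s c <= 2)%N -> (d s e <= 2)%N ->
    (d o b <= 2)%N -> (d o c <= 2)%N -> (d o e <= 2)%N ->
  (f c o e - f c s e) - (f a p b - f a q b)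
    = (f b o e - f b q e) + (f a s c - f a p c)
      - ((f b o c - f b p c) + (f a s e - f a q e)).
Proof.
move=> ab ac ae bc be ce pa pb pc qa qb qe sa sc se ob oc oe.
have [_ fl _] := af.
have Ht := cf ab ac ae bc be ce.
have Hp := cf pa pb pc ab ac bc.
have Hq := cf qa qb qe ab ae be.
have Hs := cf sa sc se ac ae ce.
have Ho := cf ob oc oe bc be ce.
rewrite !(fl a p) !(fl b p) in Hp; rewrite !(fl a q) !(fl b q) in Hq.
rewrite !(fl a s) !(fl c s) in Hs; rewrite !(fl b o) !(fl c o) in Ho.
have L : f b c e - f a c e + f a b e - f a b c
   - (f b c e - - f c o e + - f b o e - - f b o c)
   + (f a c e - - f c s e + - f a s e - - f a s c)
   - (f a b e - - f b q e + - f a q e - - f a q b)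
   + (f a b c - - f b p c + - f a p c - - f a p b) = 0.
  by rewrite Ht Hp Hq Hs Ho !(subr0, addr0).
apply/eqP; rewrite -subr_eq0 -oppr_eq0 -[X in _ == X]L; apply/eqP; ring.
Qed.

(** The sum of [S] over the six faces of a 3-cube is zero. *)
Lemma square_cube u i j l :
  S (flip u l) i j - S u i j =
  (S (flip u j) i l - S u i l) - (S (flip u i) j l - S u j l).
Proof.
have SE v i' j' : S v i' j' = - S (flip v i') i' j' by rewrite square_flipl opprK.
rewrite (SE (flip u l)) (SE (flip u j)) (SE (flip u i)) /square.
rewrite !flipK.
rewrite (flipC (flip u j) i l) (flipC u j l) (flipC u j i) (flipC (flip u l) j i).
rewrite (flipC (flip u i) j l) (flipC u i l).
rewrite (flipC (flip u l) i j).
have near x i' : (d (flip x i') x <= 2)%N by rewrite hammingC hamming_flip.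
have nearC x i' : (d x (flip x i') <= 2)%N by rewrite hamming_flip.
have T : _ = _ := @tetrahedron_cocycle u (flip (flip u i) j) (flip (flip u l) i)
  (flip (flip u l) j) (flip u i) (flip u j) (flip u l) (flip (flip (flip u l) j) i)
  (hamming_le2 _ _ _) (hamming_le2 _ _ _) (hamming_le2 _ _ _) _ _ (hamming_flips_le2 _ _ _)
  (near _ _) (nearC _ _) _ (near _ _) _ _ (near _ _) (nearC _ _) (nearC _ _)
  _ _ (near _ _).
transitivity (f (flip (flip u l) i) (flip (flip (flip u l) j) i) (flip (flip u l) j)
  - f (flip (flip u l) i) (flip u l) (flip (flip u l) j)
  - (f u (flip u i) (flip (flip u i) j) - f u (flip u j) (flip (flip u i) j))).
  by ring.
rewrite T; first by ring.
- by rewrite (flipC u l) hamming_flips_le2.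
- by rewrite (flipC u i) (flipC u l j) hamming_flips_le2.
- by rewrite flipC nearC.
- by rewrite flipC nearC.
- by rewrite flipC nearC.
- by rewrite (flipC u l) (flipC _ l i) (flipC u j) near.
- by rewrite flipC near.
Qed.

End Square.

(** Up to sign, the sum of the squares that join the edge (x, flip x i) to its image under
    clearing all the bits above [i], where the image is a tree edge. *)
Definition ladder f x i :=
  - \sum_(l < k) (if (i < l)%N && tnth x l then square f (truncate l x) i l else 0).

Section Ladder.
Variable f : V -> V -> V -> K.
Hypotheses (af : skew3 f) (cf : cocycle2 2 f).
Local Notation S := (square f).
Local Notation H := (ladder f).

Lemma ladder_flip x i : H (flip x i) i = - H x i.
Proof.
rewrite /ladder; congr (- _); rewrite -sumrN; apply: eq_bigr => l _.
rewrite tnth_flip; have [il|] := ltnP i l; last by rewrite oppr0.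
have /negPf -> : l != i by rewrite -val_eqE neq_ltn il orbT.
by rewrite addbF /= truncate_flip il; case: ifP; rewrite ?oppr0 // square_flipl.
Qed.

(** Each bit l > j of [x] contributes, by [square_cube], the difference of [S]
    between two successive truncations of [x]; the bit j starts the telescope. *)
Lemma ladder_square x i j : (i < j)%N ->
  H x i + H (flip x i) j - H x j - H (flip x j) i = S x i j.
Proof.
move=> ij.
pose a (n : nat) := if (n <= j)%N then 0 else S (truncate n x) i j.
have ak : a k = S x i j by rewrite /a truncate_id leqNgt ltn_ord.
have -> : S x i j = \sum_(l < k) (a l.+1 - a l).
  by rewrite -(big_mkord xpredT (fun l : nat => a l.+1 - a l)) telescope_sumr // ak subr0.
have -> : H x i + H (flip x i) j - H x j - H (flip x j) i
    = (H x i - H (flip x j) i) + (H (flip x i) j - H x j) by ring.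
rewrite /ladder !opprK -!sumrN -!big_split; apply: eq_bigr => l _ /=.
rewrite !tnth_flip !truncate_flip /a !ltnNge.
case: (ltngtP l j) => [lj|jl|/val_inj lj].
- have /negPf -> : l != j by rewrite -val_eqE neq_ltn lj.
  by rewrite addbF; case: (l <= i)%N; case: (tnth x l) => /=; ring.
- have il : (i < l)%N by apply: ltn_trans jl.
  have /negPf -> : l != j by rewrite -val_eqE neq_ltn jl orbT.
  have /negPf -> : l != i by rewrite -val_eqE neq_ltn il orbT.
  rewrite !addbF leqNgt il /= truncateS; case: ifP => xl; last by ring.
  rewrite square_cube //; ring.
rewrite lj eqxx truncateS; have /negPf -> : j != i by rewrite -val_eqE neq_ltn ij orbT.
rewrite leqNgt ij /= addbT; case: (tnth x j) => /=; rewrite ?square_flipr //; ring.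
Qed.

(** The function [ladder] as a function of the two ends of the edge; the sum has
    at most one term. *)
Definition ladder_cochain x y := \sum_(i < k | y == flip x i) H x i.

Lemma ladder_cochain_flip x i : ladder_cochain x (flip x i) = H x i.
Proof.
by rewrite /ladder_cochain (big_pred1 i) // => j; rewrite (inj_eq (@flip_inj _ x)) eq_sym.
Qed.

Lemma skew2_ladder_cochain : skew2 ladder_cochain.
Proof.
split=> [x|x y]; first by rewrite /ladder_cochain big_pred0 // => i; apply: flip_neq.
rewrite /ladder_cochain -sumrN; apply: eq_big => [i|i /eqP ->]; first exact: flip_eq.
by rewrite ladder_flip opprK.
Qed.

Lemma square_cobd_ladder u i j : i != j ->
  S u i j = square (cobd ladder_cochain) u i j.
Proof.
have sq : square (cobd ladder_cochain) u i j = H u i + H (flip u i) j - H u j - H (flip u j) i.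
  by rewrite /square /cobd (flipC u i j) !ladder_cochain_flip -flipC ladder_cochain_flip; ring.
rewrite sq -val_eqE neq_ltn => /orP[ij|ji]; first by rewrite ladder_square.
by rewrite squareC -ladder_square //; ring.
Qed.

End Ladder.

Lemma square_sub f f' u i j :
  square (fun x y z => f x y z - f' x y z) u i j = square f u i j - square f' u i j.
Proof. by rewrite /square; ring. Qed.

Lemma midpoint_square f : (forall u i j, i != j -> square f u i j = 0) ->
  forall u v m m', d u v = 2 -> (d u m < 2)%N -> (d m v < 2)%N ->
  (d u m' < 2)%N -> (d m' v < 2)%N -> f u m v = f u m' v.
Proof.
move=> sq u v m m' uv um mv um' m'v.
have := hamming_triangle m u v; have := hamming_triangle m' u v; rewrite uv => h h'.
have [i mE] : exists i, m = flip u i by apply: hamming1P; lia.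
have [i' m'E] : exists i, m' = flip u i by apply: hamming1P; lia.
have [j vE] : exists i, v = flip m i by apply: hamming1P; lia.
have [j' v'E] : exists i, v = flip m' i by apply: hamming1P; lia.
have ji : j != i.
  by apply: contra_eq_neq uv => ji; rewrite vE mE ji flipK hammingxx.
have ji' : j' != i'.
  by apply: contra_eq_neq uv => e; rewrite v'E m'E e flipK hammingxx.
have [ii'|ii'] := eqVneq i i'; first by rewrite mE m'E ii'.
have i'j : i' = j.
  apply/eqP; have := congr1 (fun v => tnth v i') (etrans (esym vE) v'E).
  rewrite /= mE m'E !tnth_flip eqxx (eq_sym i' i) (negPf ii') (eq_sym i' j') (negPf ji').
  by case: (tnth u i') (i' == j) => -[].
rewrite eq_sym in ji.
apply/eqP; rewrite -subr_eq0 -[X in _ == X](sq u i j ji) /square -i'j.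
by rewrite -mE -m'E i'j -vE.
Qed.

(** Two midpoints at distance less than [r] give the same value by the cocycle
    condition. A midpoint is first moved to the geodesic from [u] to [v] by
    taking a median. Two points of the interval at distance [r] are antipodal in it;
    as r > 2, one of them is at distance at least 2 from [u] or from [v], and the
    neighbour of this end on the way to it is close to both. *)
Lemma midpoint_indep r f : (2 < r)%N -> skew3 f -> cocycle2 r f ->
  (forall x y z, (d x y < r)%N -> (d x z < r)%N -> (d y z < r)%N -> f x y z = 0) ->
  forall u v m m', d u v = r -> (d u m < r)%N -> (d m v < r)%N ->
     (d u m' < r)%N -> (d m' v < r)%N -> f u m v = f u m' v.
Proof.
move=> r2 af cf f_lt u v; have [f0 fl fr] := af.
have near m m' : d u v = r -> (d u m < r)%N -> (d m v < r)%N ->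
    (d u m' < r)%N -> (d m' v < r)%N -> (d m m' < r)%N -> f u m v = f u m' v.
  move=> uv um mv um' m'v mm'.
  have := cf u m m' v; rewrite (f_lt m m' v) // (f_lt u m m') // sub0r subr0 uv.
  by move/(_ (ltnW um) (ltnW um') (leqnn _) (ltnW mm') (ltnW mv) (ltnW m'v))/eqP;
    rewrite addrC subr_eq0 => /eqP.
have geod m : d u v = r -> (d u m < r)%N -> (d m v < r)%N -> exists q,
    [/\ (d u q + d q v)%N = r, (0 < d u q)%N, (0 < d q v)%N & f u m v = f u q v].
  move=> uv um mv; have [h1 h2 h3] := hamming_median u v m.
  exists (median u v m); set q := median u v m in h1 h2 h3 *.
  have h4 := hammingC q u; have h5 := hammingC q m; have h6 := hammingC m v.
  by split; try lia; apply: near => //; lia.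
have main q q' : (d u q + d q v)%N = r -> (0 < d u q)%N -> (0 < d q v)%N ->
    (d u q' + d q' v)%N = r -> (0 < d u q')%N -> (0 < d q' v)%N ->
    d u v = r -> f u q v = f u q' v.
  move=> h1 h2 h3 h1' h2' h3' uv.
  have [qq'|qq'] := ltnP (d q q') r; first by apply: near => //; lia.
  have t1 := hamming_triangle u q q'; have t2 := hamming_triangle v q q'.
  have c1 := hammingC q u; have c2 := hammingC v q'.
  (* q and q' are antipodal: d u q' = d q v and d q' v = d u q *)
  have [uq2|uq1] := ltnP 1 (d u q).
    have [p [up pq]] := step_towards h2.
    have t3 := hamming_triangle q p v; have t4 := hamming_triangle u p q'.
    have c3 := hammingC p u; have c4 := hammingC p q.
    by rewrite (near q p) ?(near p q') //; lia.
  have [p [vp pq]] : exists m, d v m = 1%N /\ (d m q).+1 = d v q.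
    by apply: step_towards; rewrite hammingC.
  have t3 := hamming_triangle q u p; have t4 := hamming_triangle v p q'.
  have c3 := hammingC p v; have c4 := hammingC p q; have c5 := hammingC v q.
  by rewrite (near q p) ?(near p q') //; lia.
move=> m m' uv um mv um' m'v.
have [q [h1 h2 h3 ->]] := geod m uv um mv.
have [q' [h1' h2' h3' ->]] := geod m' uv um' m'v.
exact: main.
Qed.

(** By induction on [r]: subtracting the coboundary of a primitive at scale r - 1
    leaves a cocycle that vanishes on the triangles of diameter less than [r], to
    which [cobounds2_step] applies. *)
Lemma cobounds2_skew r f : skew3 f -> cocycle2 r f ->
  exists g, skew2 g /\ cobounds2 r f g.
Proof.
elim: r f => [|r IH] f af cf; first exists (fun _ _ => 0).
  split=> [|x y z xy xz yz]; first by split=> *; rewrite ?oppr0.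
  by rewrite /cobd subrr addr0; apply: (@skew3_eq0_small 0).
case: r IH cf => [_|r IH] cf.
  exists (fun _ _ => 0); split=> [|x y z xy xz yz]; first by split=> *; rewrite ?oppr0.
  by rewrite /cobd subrr addr0; apply: (@skew3_eq0_small 1).
have wk s (F : V -> V -> V -> K) : cocycle2 s.+1 F -> cocycle2 s F.
  by move=> cF x y z w *; apply: cF; apply: leqW.
(* At scale 2 the square function is integrated along the tree; at larger scales
   the induction hypothesis suffices. *)
have [g [ag fg ind]] : exists g, [/\ skew2 g,
    forall x y z, (d x y < r.+2)%N -> (d x z < r.+2)%N -> (d y z < r.+2)%N ->
      f x y z - cobd g x y z = 0 &
    forall u v m m', d u v = r.+2 -> (d u m < r.+2)%N -> (d m v < r.+2)%N ->
     (d u m' < r.+2)%N -> (d m' v < r.+2)%N ->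
     f u m v - cobd g u m v = f u m' v - cobd g u m' v].
  case: r IH cf => [|r] IH cf.
    have ag := skew2_ladder_cochain af cf; exists (ladder_cochain f); split=> //.
      move=> x y z xy xz yz;
        apply: (@skew3_eq0_small 1 (fun x y z => f x y z - cobd (ladder_cochain f) x y z)) => //.
      exact/skew3_sub/skew3_cobd.
    apply: (@midpoint_square (fun x y z => f x y z - cobd (ladder_cochain f) x y z)) => u i j ij.
    by rewrite square_sub (square_cobd_ladder af cf) // subrr.
  have [g [ag fg]] := IH f af (wk _ _ cf); exists g.
  have f_lt x y z : (d x y < r.+3)%N -> (d x z < r.+3)%N -> (d y z < r.+3)%N ->
      f x y z - cobd g x y z = 0.
    by move=> *; rewrite fg ?subrr.
  split=> //.
  apply: (@midpoint_indep r.+3 (fun x y z => f x y z - cobd g x y z)) => //.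
    exact/skew3_sub/skew3_cobd.
  exact: cocycle2_sub_cobd.
have [g' [ag' fg']] := @cobounds2_step r.+2 (fun x y z => f x y z - cobd g x y z)
  isT (skew3_sub af (skew3_cobd ag)) (@cocycle2_sub_cobd r.+2 f g cf) fg ind.
exists (fun x y => g x y + g' x y); split; first exact: skew2D.
exact: cobounds2_add.
Qed.

Theorem cocycle2_cobounds r f : cocycle2 r f -> exists g, cobounds2 r f g.
Proof.
move=> /cocycle2_skew [f' [g [af' cf' fE]]].
have [g' [_ f'g']] := cobounds2_skew af' cf'.
exists (fun x y => g x y + g' x y); apply: cobounds2_add => x y z xy xz yz.
by rewrite fE // addrK f'g'.
Qed.

End Cohomology2.

(** * One-cocycles on the cube *)

Section Cohomology1.
Variables (k : nat) (K : comNzRingType).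
Local Notation V := (k.-tuple bool).
Local Notation d := (@hamming k).
Implicit Types (x y z u v w : V) (i j l : 'I_k) (r : nat).
Implicit Types (g : V -> V -> K).

Definition cocycle1 r g := forall x y z,
  (d x y <= r)%N -> (d x z <= r)%N -> (d y z <= r)%N -> g y z - g x z + g x y = 0.

(** Integral of [g] along the tree path from the origin to [x]; the steps at the
    zero bits of [x] are constant and contribute g(z,z), which is zero for a
    cocycle. *)
Definition potential g x := \sum_(l < k) g (truncate l x) (truncate l.+1 x).

Section Cocycle1.
Variables (r : nat) (g : V -> V -> K).
Hypothesis cg : cocycle1 r g.

Lemma cocycle1xx x : g x x = 0.
Proof. by have := cg (x := x) (y := x) (z := x); rewrite hammingxx subrr add0r; apply. Qed.

Lemma cocycle1C x y : (d x y <= r)%N -> g y x = - g x y.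
Proof.
move=> xy; have := cg (x := x) (y := y) (z := x).
rewrite hammingxx (hammingC y) cocycle1xx subr0 => /(_ xy (leq0n _) xy) /eqP.
by rewrite addr_eq0 => /eqP.
Qed.

Lemma cocycle1_trans y x z :
  (d x y <= r)%N -> (d x z <= r)%N -> (d y z <= r)%N -> g x z = g x y + g y z.
Proof.
by move=> xy xz yz; rewrite -[LHS]addr0 -(cg xy xz yz); ring.
Qed.

Lemma potential_tree_edge x i : tree_edge x i ->
  potential g (flip x i) - potential g x = g x (flip x i).
Proof.
move=> /forallP tx; have xi : tnth x i = false.
  by have := tx i; rewrite leqnn => /negPf.
have tE : truncate i x = x.
  apply: eq_from_tnth => l; rewrite tnth_mktuple; case: ltnP => [_|il].
    by rewrite andbT.
  by have := tx l; rewrite il andbF => /negPf ->.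
rewrite /potential -sumrB (bigD1 i) //= big1 ?addr0 => [|l li].
  by rewrite !truncateS !truncate_flip ltnn tnth_flip xi eqxx /= cocycle1xx subr0 tE.
rewrite !truncateS !truncate_flip tnth_flip (negPf li) addbF.
case: ltnP => [il|_]; last by rewrite subrr.
by have := tx l; rewrite (ltnW il) /= => /negPf ->; rewrite !cocycle1xx subr0.
Qed.

Hypothesis r_gt1 : (1 < r)%N.

(** The tree paths of the two ends of an edge run in parallel above the bit [i],
    and the squares between them have diameter 2. *)
Lemma potential_flip x i : potential g (flip x i) - potential g x = g x (flip x i).
Proof.
have le2 m : (m <= 2)%N -> (m <= r)%N by move=> m2; apply: leq_trans r_gt1.
have le1 y j : (d y (flip y j) <= r)%N by apply: le2; rewrite hamming_flip.
have gflip y j : g (flip y j) y = - g y (flip y j) by apply: cocycle1C.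
pose a (n : nat) := if (n <= i)%N then 0 else g (truncate n x) (flip (truncate n x) i).
have ak : a k = g x (flip x i) by rewrite /a truncate_id leqNgt ltn_ord.
have -> : g x (flip x i) = \sum_(l < k) (a l.+1 - a l).
  by rewrite -(big_mkord xpredT (fun l : nat => a l.+1 - a l)) telescope_sumr // ak subr0.
rewrite /potential -sumrB; apply: eq_bigr => l _.
rewrite !truncateS !truncate_flip tnth_flip /a.
case: (ltngtP l i) => [li|il|/val_inj ->]; last first.
- rewrite eqxx addbT ?ltnn ?leqnn truncateS.
  case: (tnth x i) => /=; rewrite cocycle1xx ?flipK ?gflip; ring.
- have /negPf -> : l != i by rewrite -val_eqE neq_ltn il orbT.
  rewrite addbF truncateS; case: (tnth x l); last by rewrite !cocycle1xx; ring.
  set y := truncate l x.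
  have e1 : g y (flip (flip y i) l) = g y (flip y l) + g (flip y l) (flip (flip y i) l).
    apply: cocycle1_trans => //; first by apply: le2; rewrite hamming_le2.
    by rewrite flipC.
  have e2 : g y (flip (flip y i) l) = g y (flip y i) + g (flip y i) (flip (flip y i) l).
    by apply: cocycle1_trans => //; apply: le2; rewrite hamming_le2.
  by rewrite (flipC y l i); move/eqP: (etrans (esym e1) e2); rewrite -subr_eq0 => /eqP e3;
    apply/eqP; rewrite eq_sym -subr_eq0 -[X in _ == X]e3; apply/eqP; ring.
by have /negPf -> : l != i; rewrite ?addbF ?subrr // -val_eqE neq_ltn li.
Qed.

Theorem cocycle1_potential x y : (d x y <= r)%N -> g x y = potential g y - potential g x.
Proof.
elim: (d x y) {-2}x (leqnn (d x y)) => [|n IH] {}x xyn xy.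
  by move: xyn; rewrite leqn0 hamming_eq0 => /eqP ->; rewrite cocycle1xx subrr.
have [xy0|xy1] := posnP (d x y); first by rewrite IH ?xy0.
have [i xyi] := hamming_gt0P xy1; have e := hamming_flipr xyi.
rewrite (@cocycle1_trans (flip x i)) ?hamming_flip ?e //; try lia.
by rewrite -potential_flip IH ?e; try lia; ring.
Qed.

End Cocycle1.

(** Subtracting the coboundary of the potential does not change the pairing with
    the cycle [c] and makes [g] zero on the tree edges. *)
Lemma tree_pairing (g c : V -> V -> K) : cocycle1 1 g ->
  (forall u v, (1 < d u v)%N -> c u v = 0) ->
  (forall v, \sum_u (c u v - c v u) = 0) ->
  (forall u i, ~~ tnth u i -> ~~ tree_edge u i -> c u (flip u i) = c (flip u i) u) ->
  \sum_u \sum_v c u v * g u v = 0.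
Proof.
move=> cg c_le1 c_cycle c_tree; pose p := potential g.
pose F u v := c u v * (g u v - p v + p u).
have -> : \sum_u \sum_v c u v * g u v = \sum_u \sum_v F u v
    + \sum_v \sum_u (c u v - c v u) * p v.
  have -> : \sum_v \sum_u (c u v - c v u) * p v =
      \sum_u \sum_v c u v * p v - \sum_u \sum_v c u v * p u.
    rewrite [X in X - _]exchange_big -sumrB; apply: eq_bigr => v _ /=.
    by rewrite -sumrB; apply: eq_bigr => u _; rewrite mulrBl.
  rewrite -sumrB -big_split; apply: eq_bigr => u _ /=.
  rewrite -sumrB -big_split; apply: eq_bigr => v _ /=; rewrite /F; ring.
rewrite [X in _ + X]big1 ?addr0 => [|v _]; last first.
  by rewrite -mulr_suml c_cycle mul0r.
have up u i : ~~ tnth u i -> F (flip u i) u = - F u (flip u i).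
  move=> ui; rewrite /F (cocycle1C cg) ?hamming_flip //.
  have [/(potential_tree_edge cg) <-|nt] := boolP (tree_edge u i); first by rewrite /p; ring.
  by rewrite (c_tree u i) //; ring.
apply: sum_skew => u; first by rewrite /F (cocycle1xx cg) subrK mulr0.
move=> v; case: (ltngtP (d u v) 1%N) => [|uv|uv].
- rewrite ltnS leqn0 hamming_eq0 => /eqP ->.
  by rewrite /F (cocycle1xx cg) subrK mulr0 oppr0.
- by rewrite /F !c_le1 ?mul0r ?oppr0 // hammingC.
have [i ->] := hamming1P uv; have [ui|/up //] := boolP (tnth u i).
have := @up (flip u i) i; rewrite flipK tnth_flip eqxx ui => /(_ isT) ->.
by rewrite opprK.
Qed.

End Cohomology1.

(** * Low-dimensional simplices of the cube *)

Section CubeSimplices.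
Variables (R : realType) (kappa : fieldType) (k : nat).
Local Notation V := (k.-tuple bool).
Local Notation X := (hamming_cube R k).
Local Notation d := (@hamming k).
Local Notation A := (polyR R kappa).
Local Notation N := (@nnreal_nat R).
Implicit Types (x y z : V) (t : nnreal R).

Definition v1 x : simplex X 0 := [tuple x].

Definition v2 x y : simplex X 1 := [tuple x; y].

Definition v3 x y z : simplex X 2 := [tuple x; y; z].

Definition v4 x y z w : simplex X 3 := [tuple x; y; z; w].

Lemma v1P (s : simplex X 0) : exists x, s = v1 x.
Proof. by case/tupleP: s => x s; exists x; apply: val_inj; rewrite /= tuple0. Qed.

Lemma v2P (s : simplex X 1) : exists x y, s = v2 x y.
Proof.
case/tupleP: s => x s; case/tupleP: s => y s; exists x, y; apply: val_inj.
by rewrite /= (tuple0 s).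
Qed.

Lemma v3P (s : simplex X 2) : exists x y z, s = v3 x y z.
Proof.
case/tupleP: s => x s; case/tupleP: s => y s; case/tupleP: s => z s.
by exists x, y, z; apply: val_inj; rewrite /= (tuple0 s).
Qed.

Lemma v2_inj x y x' y' : v2 x y = v2 x' y' -> x = x' /\ y = y'.
Proof. by case. Qed.

Lemma sum_v1 (B : zmodType) (f : simplex X 0 -> B) : \sum_s f s = \sum_x f (v1 x).
Proof.
rewrite (reindex (v1)) //; apply: onW_bij.
exists (fun s : simplex X 0 => tnth s ord0) => [x|s] //.
by have [x ->] := v1P s.
Qed.

Lemma sum_v2 (B : zmodType) (f : simplex X 1 -> B) :
  \sum_s f s = \sum_x \sum_y f (v2 x y).
Proof.
rewrite pair_bigA /= (reindex (fun p : V * V => v2 p.1 p.2)) //; apply: onW_bij.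
exists (fun s : simplex X 1 => (tnth s ord0, tnth s (lift ord0 ord0))) => [[x y]|s] //.
by have [x [y ->]] := v2P s.
Qed.

Lemma sum_face_v2 (B : nzRingType) (f : simplex X 0 -> B) x y :
  \sum_(i < 2) (-1) ^+ i * f (face i (v2 x y)) = f (v1 y) - f (v1 x).
Proof.
rewrite !big_ord_recl big_ord0 addr0 expr0 mul1r expr1 mulN1r.
by congr (f _ - f _); apply: eq_from_tnth => j; rewrite tnth_mktuple !(tnth_nth x);
  case: j => -[|//] lj.
Qed.

Lemma sum_face_v3 (B : nzRingType) (f : simplex X 1 -> B) x y z :
  \sum_(i < 3) (-1) ^+ i * f (face i (v3 x y z))
    = f (v2 y z) - f (v2 x z) + f (v2 x y).
Proof.
rewrite !big_ord_recl big_ord0 addr0 expr0 mul1r expr1 mulN1r sqrrN expr1n mul1r addrA.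
by congr (f _ - f _ + f _); apply: eq_from_tnth => j; rewrite tnth_mktuple !(tnth_nth x);
  case: j => -[|[|//]] lj.
Qed.

Lemma sum_face_v4 (B : nzRingType) (f : simplex X 2 -> B) x y z w :
  \sum_(i < 4) (-1) ^+ i * f (face i (v4 x y z w))
    = f (v3 y z w) - f (v3 x z w) + f (v3 x y w) - f (v3 x y z).
Proof.
rewrite !big_ord_recl big_ord0 addr0 expr0 mul1r expr1 mulN1r sqrrN expr1n mul1r.
rewrite exprS sqrrN expr1n mulr1 mulN1r !addrA.
by congr (f _ - f _ + f _ - f _); apply: eq_from_tnth => j; rewrite tnth_mktuple !(tnth_nth x);
  case: j => -[|[|[|//]]] lj.
Qed.

(** Distances are integers, so a bound by [t] is a bound by its integer part. *)
Lemma diam_truncn n (s : simplex X n) t :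
  (diam s <= t)%O <-> forall i j, (d (tnth s i) (tnth s j) <= Num.truncn t%:num)%N.
Proof.
have dE x y : (d x y <= Num.truncn t%:num)%N = (hamming_dist R x y <= t)%O.
  by rewrite truncn_ge_nat.
split=> [st i j|st]; first by rewrite dE; apply: le_trans st; apply: (diam_ge s i j).
apply: bigmax_le => [|i _]; first exact: nnreal_ge0.
by apply: bigmax_le => [|j _]; [exact: nnreal_ge0|rewrite -[(_ <= _)%O]dE].
Qed.

Lemma diam_v1 x : diam (v1 x) = N 0.
Proof.
apply: le_anti; apply/andP; split; last exact: nnreal_ge0.
by apply/diam_truncn => i j; rewrite !ord1 hammingxx.
Qed.

Lemma diam_v2 x y : diam (v2 x y) = N (d x y).
Proof.
apply: le_anti; apply/andP; split.
  apply/diam_truncn => i j; rewrite /= natrK !(tnth_nth x).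
  by case: i j => -[|[|//]] ? [[|[|//]] ?]; rewrite /= ?hammingxx // hammingC.
exact: (diam_ge (v2 x y) ord0 (lift ord0 ord0)).
Qed.

Lemma diam_v3 x y z t : (diam (v3 x y z) <= t)%O <->
  [/\ d x y <= Num.truncn t%:num, d x z <= Num.truncn t%:num
    & d y z <= Num.truncn t%:num]%N.
Proof.
split=> [/diam_truncn st|[xy xz yz]].
  pose o (i : nat) : 'I_3 := inord i.
  by split; [have := st (o 0) (o 1)|have := st (o 0) (o 2)|have := st (o 1) (o 2)];
    rewrite !(tnth_nth x) !inordK.
apply/diam_truncn => i j; rewrite !(tnth_nth x).
by case: i j => -[|[|[|//]]] ? [[|[|[|//]]] ?]; rewrite /= ?hammingxx // hammingC.
Qed.

Lemma diam_v3E x y z : diam (v3 x y z) = N (maxn (maxn (d x y) (d x z)) (d y z)).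
Proof.
apply: le_anti; apply/andP; split; first by apply/diam_v3; rewrite natrK; split; lia.
have [h1 h2 h3] := (diam_v3 x y z (diam (v3 x y z))).1 (lexx _).
rewrite -[(_ <= _)%O]/(_%:R <= (diam (v3 x y z))%:num) -truncn_ge_nat // !geq_max.
by rewrite h1 h2 h3.
Qed.

Lemma diam_v4 x y z w t :
  (d x y <= Num.truncn t%:num)%N -> (d x z <= Num.truncn t%:num)%N ->
  (d x w <= Num.truncn t%:num)%N -> (d y z <= Num.truncn t%:num)%N ->
  (d y w <= Num.truncn t%:num)%N -> (d z w <= Num.truncn t%:num)%N ->
  (diam (v4 x y z w) <= t)%O.
Proof.
move=> xy xz xw yz yw zw; apply/diam_truncn => i j; rewrite !(tnth_nth x).
by case: i j => -[|[|[|[|//]]]] ? [[|[|[|[|//]]]] ?]; rewrite /= ?hammingxx // hammingC.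
Qed.

End CubeSimplices.

(** * Degree two *)

Theorem cycles2_boundaries (R : realType) (kappa : fieldType) (k : nat) :
  {subset @cycles R kappa (hamming_cube R k) 2 <= @boundaries R kappa (hamming_cube R k) 2}.
Proof.
apply: (homogeneous_sub (@cycles_homogeneous _ _ _ 2)) => t z /homog_mono [c [c_supp ->]].
rewrite inE => /eqP bc; apply: mono_boundaryP => // f f_cocycle.
pose r := Num.truncn t%:num.
have [|g fg] := @cocycle2_cobounds k kappa r (fun x y z => f (v3 R x y z)).
  move=> x y z' w xy xz xw yz yw zw; rewrite -sum_face_v4; apply: f_cocycle.
  exact: diam_v4.
apply: (@pairing_cobd _ _ _ _ t c f (fun s => g (tnth s ord0) (tnth s (lift ord0 ord0)))) => // s.
have [x [y [z' ->]]] := v3P s => /diam_v3 [xy xz yz].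
by rewrite fg // (sum_face_v3 (fun s => g (tnth s ord0) (tnth s (lift ord0 ord0)))).
Qed.

(** * Degree zero *)

Section TreePaths.
Variables (R : realType) (kappa : fieldType) (k : nat).
Local Notation V := (k.-tuple bool).
Local Notation X := (hamming_cube R k).
Local Notation d := (@hamming k).
Local Notation A := (polyR R kappa).
Local Notation N := (@nnreal_nat R).
Local Notation chain := (chain kappa X).
Implicit Types (x y z u v : V) (t : nnreal R).

Definition tree_path x : chain 1 :=
  \sum_(l < k | tnth x l) gen kappa (v2 R (truncate l x) (flip (truncate l x) l)).

Lemma bd_gen_v2 x y : bd_gen kappa (v2 R x y) =
  Tpow kappa (N (d x y)) *: (gen kappa (v1 R y) - gen kappa (v1 R x)).
Proof.
apply/ffunP => s; rewrite bd_gen_val.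
have diam_vertex j : nnrealB (diam (v2 R x y)) (diam (face j (v2 R x y))) = N (d x y).
  have [z ->] := v1P (face j (v2 R x y)).
  rewrite diam_v1 diam_v2.
  by apply: nnreal_inj; rewrite nnrealBE /= ?subr0 //; apply: nnreal_ge0.
under eq_bigr do rewrite diam_vertex mulrCA.
rewrite -mulr_sumr (sum_face_v2 (fun s' => (s == s')%:R)).
by rewrite !ffunE.
Qed.

Lemma bd_edge x i : bd (gen kappa (v2 R x (flip x i))) =
  Tpow kappa (N 1) *: (gen kappa (v1 R (flip x i)) - gen kappa (v1 R x)).
Proof. by rewrite bd_genE bd_gen_v2 hamming_flip. Qed.

Lemma bd_tree_path x :
  bd (tree_path x) = Tpow kappa (N 1) *: (gen kappa (v1 R x) - gen kappa (v1 R (origin k))).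
Proof.
rewrite /tree_path linear_sum; under eq_bigr do rewrite /= bd_edge.
rewrite -scaler_sumr big_mkcond /=; congr (_ *: _).
rewrite -(truncate0 x).
pose u (n : nat) : chain 0 := gen kappa (v1 R (truncate n x)).
have <- : \sum_(l < k) (u l.+1 - u l) = gen kappa (v1 R x) - gen kappa (v1 R (truncate 0 x)).
  by rewrite -(big_mkord xpredT (fun l => u l.+1 - u l)) (telescope_sumr u) // /u truncate_id.
apply: eq_bigr => l _; rewrite /u truncateS; case: ifP => // _.
by rewrite [RHS](subrr (u l)).
Qed.

Lemma chain0E (z : chain 0) : z = \sum_x (z (v1 R x) : A) *: gen kappa (v1 R x).
Proof.
rewrite -(@sum_v1 R k _ (fun s : simplex X 0 => (z s : A) *: gen kappa s)); exact: ffun_delta_sum.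
Qed.

Section Degree0.
Variables (m : nat) (e : 'I_m -> V).
Hypotheses (e_inj : injective e) (eP : forall x, x \in [set~ origin k] <-> exists j, x = e j).

Local Notation bar01 := (bar kappa (N 0) (N 1)).

Definition coord0 (z : chain 0) : ({ffun 'I_m -> bar01} * A^o)%type :=
  ([ffun j => to_quotmod (Tideal (nnrealB (N 1) (N 0))) (z (v1 R (e j)))], \sum_s z s).

Lemma coord0_linear : linear coord0.
Proof.
move=> a x y; congr pair.
  by apply/ffunP => j; rewrite !ffunE linearP.
rewrite -[RHS]/(a *: (\sum_s x s) + \sum_s y s) scaler_sumr -big_split.
by apply: eq_bigr => s _; rewrite !ffunE.
Qed.
HB.instance Definition _ := GRing.isLinear.Build A (chain 0)
  ({ffun 'I_m -> bar01} * A^o)%type *:%R coord0 coord0_linear.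

Lemma coord0_graded : graded_map (chain_grading kappa X 0)
  (gmod_grading (gmod_dsum (gmod_power bar01 m) (bar_infty kappa (N 0)))) coord0.
Proof.
move=> t z Gz.
have Gz0 s : shift_grading (reg_grading R kappa) (N 0) t (z s).
  by have := Gz s; have [x ->] := v1P s; rewrite diam_v1.
split; last exact: homog_sum.
by move=> j; rewrite ffunE; exists (z (v1 R (e j))).
Qed.

Lemma bar01_shift : nnrealB (N 1) (N 0) = N 1.
Proof. by rewrite nnrealBnat. Qed.

Lemma coord0_bd_gen (s : simplex X 1) : coord0 (bd_gen kappa s) = 0.
Proof.
have [x [y ->]] := v2P s; rewrite bd_gen_v2; congr pair.
  apply/ffunP => j; rewrite !ffunE; apply/quotmod_eq0; rewrite bar01_shift.
  have [|] := posnP (d x y).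
    by move/eqP; rewrite hamming_eq0 => /eqP ->; rewrite subrr scaler0 rpred0.
  by move=> xy; apply: Tpow_ideal; rewrite nnreal_nat_le.
under eq_bigr do rewrite !ffunE.
by rewrite -scaler_sumr sumrB !sum_delta subrr scaler0.
Qed.

(** A chain with zero sum is a combination of the differences of [x] and the
    origin, and T times such a difference is the boundary of a tree path. *)
Lemma coord0_boundary (z : chain 0) : coord0 z = 0 -> z \in @boundaries R kappa X 0.
Proof.
move=> [/ffunP z0 /eqP]; rewrite (@sum_v1 R k) => /eqP sz.
have -> : z = \sum_x (z (v1 R x) : A) *: (gen kappa (v1 R x) - gen kappa (v1 R (origin k))).
  by rewrite {1}(chain0E z); apply: sum_scale_sub.
apply: rpred_sum => x _.
have [->|x0] := eqVneq x (origin k); first by rewrite subrr scaler0 rpred0.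
have [j xE] := (eP x).1 (etrans (in_setC1 _ _) x0).
have := z0 j; rewrite !ffunE => /quotmod_eq0; rewrite bar01_shift -xE => /TidealP[a ->].
have -> : (a * Tpow kappa (N 1)) *: (gen kappa (v1 R x) - gen kappa (v1 R (origin k)))
    = a *: bd (tree_path x) by rewrite bd_tree_path scalerA.
by apply: rpredZ; apply/imlP; exists (tree_path x).
Qed.

Lemma coord0_surj (u : {ffun 'I_m -> bar01} * A^o) :
  exists2 z, z \in @cycles R kappa X 0 & coord0 z = u.
Proof.
case: u => y w.
have [|j|z [zy zw]] := @interpolate_sum A (simplex X 0) m (fun j => v1 R (e j)) (v1 R (origin k))
  (fun j => repr (y j)) w.
- by move=> i j [] /e_inj.
- apply: contraTneq isT => -[ej].
  by have := (eP (e j)).2 (ex_intro _ j erefl); rewrite in_setC1 ej eqxx.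
exists [ffun s => z s] => //; congr pair.
  by apply/ffunP => j; rewrite !ffunE zy to_quotmodK.
by rewrite -[RHS]zw; apply: eq_bigr => s _; rewrite ffunE.
Qed.

Lemma PH0_iso : graded_iso (PH kappa X 0)
  (gmod_dsum (gmod_power bar01 m) (bar_infty kappa (N 0))).
Proof.
apply: (@PH_graded_iso R kappa X 0 (gmod_dsum (gmod_power bar01 m) (bar_infty kappa (N 0))) coord0).
- exact: coord0_graded.
- by move=> z /coord0_boundary.
- exact: coord0_bd_gen.
- exact: coord0_surj.
Qed.

End Degree0.

(** * Degree one *)

Section Degree1.
Variables (m : nat) (e : 'I_m -> V * 'I_k).
Hypotheses (e_inj : injective e) (eP : forall p, p \in extra_edges k <-> exists j, p = e j).

Local Notation bar12 := (bar kappa (N 1) (N 2)).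

Definition edge_up (p : V * 'I_k) := v2 R p.1 (flip p.1 p.2).

Definition edge_down (p : V * 'I_k) := v2 R (flip p.1 p.2) p.1.

Lemma diam_edge_up p : diam (edge_up p) = N 1.
Proof. by rewrite diam_v2 hamming_flip. Qed.

Lemma diam_edge_down p : diam (edge_down p) = N 1.
Proof. by rewrite diam_v2 hammingC hamming_flip. Qed.

Lemma edge_up_eq p q : (edge_up p == edge_up q) = (p == q).
Proof.
apply/eqP/eqP => [|->] //; case: p q => [x i] [y j] /(@v2_inj R k) /= [-> /flip_inj ->] //.
Qed.

Lemma edge_up_down p q : ~~ tnth p.1 p.2 -> ~~ tnth q.1 q.2 -> (edge_up p == edge_down q) = false.
Proof.
case: p q => [x i] [y j] /= xi yj; apply/eqP => /(@v2_inj R k) /= [xE yE].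
have ij : i = j by apply: (@flip_inj _ x); rewrite yE xE flipK.
by move: xi; rewrite ij xE tnth_flip eqxx addbT yj.
Qed.

Lemma extra_edgeP j : ~~ tnth (e j).1 (e j).2 /\ ~~ tree_edge (e j).1 (e j).2.
Proof.
by have := (eP (e j)).2 (ex_intro _ j erefl); rewrite inE => /andP.
Qed.

(** The coefficient of an edge counts both of its orientations, with opposite
    signs, which makes degenerate triangles such as (x,y,x) invisible. *)
Definition coord1 (z : chain 1) : {ffun 'I_m -> bar12} :=
  [ffun j => to_quotmod (Tideal (nnrealB (N 2) (N 1))) (z (edge_up (e j)) - z (edge_down (e j)))].

Lemma coord1_linear : linear coord1.
Proof.
move=> a x y; apply/ffunP => j; rewrite !ffunE -linearP; congr to_quotmod.
by rewrite scalerBr opprD addrACA.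
Qed.
HB.instance Definition _ := GRing.isLinear.Build A (chain 1)
  {ffun 'I_m -> bar12} *:%R coord1 coord1_linear.

Lemma coord1_graded : graded_map (chain_grading kappa X 1)
  (gmod_grading (gmod_power bar12 m)) coord1.
Proof.
move=> t z Gz j; rewrite ffunE; exists (z (edge_up (e j)) - z (edge_down (e j))) => //.
apply: homogB; first by have := Gz (edge_up (e j)); rewrite diam_edge_up.
by have := Gz (edge_down (e j)); rewrite diam_edge_down.
Qed.

Lemma bar12_shift : nnrealB (N 2) (N 1) = N 1.
Proof. by rewrite nnrealBnat. Qed.

(** On boundaries, the coordinate at an edge is a coboundary of the skew function
    [G] that counts this edge. It vanishes on triangles of diameter at most 1,
    which are degenerate; triangles of diameter at least 2 contribute
    multiples of T. *)
Lemma coord1_bd_gen (s : simplex X 2) : coord1 (bd_gen kappa s) = 0.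
Proof.
have [x [y [z ->]]] := v3P s; apply/ffunP => j; rewrite !ffunE.
apply/quotmod_eq0; rewrite bar12_shift !bd_gen_val.
set p := e j; set D := diam (v3 R x y z).
rewrite (@sub_sign_delta A 3 (fun i => Tpow kappa (nnrealB D (diam (face i (v3 R x y z)))))
  (Tpow kappa (nnrealB D (N 1))) (fun i => edge_up p == face i (v3 R x y z))
  (fun i => edge_down p == face i (v3 R x y z))); last first.
  by move=> i /orP[] /eqP <-; rewrite ?diam_edge_up ?diam_edge_down.
rewrite (sum_face_v3 (fun s' => (edge_up p == s')%:R - (edge_down p == s')%:R : A)).
pose G u v : A := (edge_up p == v2 R u v)%:R - (edge_down p == v2 R u v)%:R.
have sG : skew2 G.
  have swap u v : (edge_up p == v2 R u v) = (edge_down p == v2 R v u).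
    by apply/eqP/eqP => /(@v2_inj R k) [<- <-].
  split=> [u|u v]; last by rewrite /G (swap v u) -(swap u v) opprB.
  by rewrite /G swap subrr.
rewrite -[X in _ * X]/(cobd G x y z).
have [D1|D2] := leqP (maxn (maxn (d x y) (d x z)) (d y z)) 1%N.
  by rewrite (skew3_eq0_small (skew3_cobd sG) (leqnn 1)) ?mulr0 ?rpred0 //; lia.
by apply: Tpow_ideal; rewrite /D diam_v3E nnrealBnat ?nnreal_nat_le; lia.
Qed.

(** A homogeneous cycle of degree [t] with zero coordinates is killed by every
    1-cocycle at the scale of [t]. *)
Lemma coord1_boundary (z : chain 1) :
  coord1 z = 0 -> z \in @cycles R kappa X 1 -> z \in @boundaries R kappa X 1.
Proof.
move=> z0 zc.
pose S := [pred z : chain 1 | (z \in @cycles R kappa X 1) && (z \in kerl coord1)].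
suff : {subset S <= @boundaries R kappa X 1}.
  by apply; apply/andP; split=> //; rewrite inE; apply/eqP.
apply: homogeneous_sub.
  apply: homogeneousI; first exact: cycles_homogeneous.
  exact: homogeneous_kerl coord1_graded.
move=> {z z0 zc} t z /homog_mono [c [c_supp ->]].
rewrite inE => /andP[]; rewrite inE => /eqP bc; rewrite inE => /eqP c0.
apply: mono_boundaryP => // f f_cocycle.
pose r := Num.truncn t%:num; pose g u v := f (v2 R u v).
have cg : cocycle1 r g.
  move=> x y z' xy xz yz; rewrite /g -(sum_face_v3 f); apply: f_cocycle.
  exact/diam_v3.
have supp2 u v : ~~ (d u v <= r)%N -> c (v2 R u v) = 0.
  move=> uv; apply: c_supp; apply: contra uv => /diam_truncn /(_ ord0 (lift ord0 ord0)).
  by [].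
(* t >= 2: every 1-cocycle is a coboundary *)
have [r2|] := ltnP 1 r.
  apply: (@pairing_cobd _ _ _ _ t c f (fun s => potential g (tnth s ord0))) => // s.
  have [x [y ->]] := v2P s => /diam_truncn /(_ ord0 (lift ord0 ord0)) xy.
  rewrite (sum_face_v2 (fun s => potential g (tnth s ord0))).
  exact: (cocycle1_potential cg).
(* t < 1: only the simplices (x,x) have nonzero coefficients *)
rewrite leq_eqVlt => /orP[/eqP r1|]; last first.
  rewrite ltnS leqn0 => /eqP r0; rewrite (@sum_v2 R k) big1 // => x _; rewrite big1 // => y _.
  have [->|xy] := eqVneq x y; first by rewrite -/(g y y) (cocycle1xx cg) mulr0.
  by rewrite supp2 ?mul0r // r0 leqn0 hamming_eq0.
rewrite (@sum_v2 R k); apply: (@tree_pairing _ _ g (fun u v => c (v2 R u v))).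
- by rewrite -r1.
- by move=> u v uv; apply: supp2; rewrite r1 -ltnNge.
- move=> v; rewrite -(sum_delta_diff (fun u v => c (v2 R u v))).
  have := @mono_eq0 _ _ _ _ t (coef_bd c) (v1 R v); rewrite -bd_mono // bc => /(_ erefl).
  rewrite /coef_bd (@sum_v2 R k) => cv; rewrite -[RHS]cv.
  apply: eq_bigr => x _; apply: eq_bigr => y _; congr (_ * _).
  rewrite (sum_face_v2 (fun s => (v1 R v == s)%:R)).
  by congr (_%:R - _%:R); congr nat_of_bool; apply/eqP/eqP => [->|[]].
(* In degree t - 1 < 1 the coordinate has no term in the ideal (T), so that being
   zero modulo T makes the coefficient itself zero. *)
move=> u i ui tui; have [j pj] := (eP (u, i)).1 ltac:(by rewrite inE ui tui).
have := congr1 (fun h : {ffun 'I_m -> bar12} => h j) c0; rewrite !ffunE.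
move=> /quotmod_eq0; rewrite bar12_shift -pj => /TidealP[a aE].
have cE : c (edge_up (u, i)) - c (edge_down (u, i))
    = mcoeff (nnrealB t (N 1)) (a * Tpow kappa (N 1)).
  by rewrite -aE diam_edge_up diam_edge_down; apply/esym/mcoeff_subU.
apply/eqP; rewrite -subr_eq0 -[X in X == _]/(c (edge_up (u, i)) - c (edge_down (u, i))) cE.
apply/eqP/mcoeff_mulT.
rewrite -[(_ < _)%O]/((nnrealB t (N 1))%:num < 1%:R) nnrealBE.
  by rewrite /= ltrBlDr -natrD -truncn_lt_nat // -/r r1.
by rewrite -[(_ <= _)%O]/(1%:R <= t%:num) -truncn_ge_nat // -/r r1.
Qed.

Lemma tree_path_coord x j : (tree_path x (edge_up (e j)) = 0) * (tree_path x (edge_down (e j)) = 0).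
Proof.
have [ej nt] := extra_edgeP j.
have pE s : (forall l, tnth x l -> (s == edge_up (truncate l x, l)) = false) -> tree_path x s = 0.
  move=> sl; rewrite /tree_path sum_ffunE big1 // => l xl; rewrite ffunE.
  by have := sl l xl; rewrite /edge_up /= => ->.
have te l := tree_edge_truncate x l.
split; apply: pE => l _.
  by rewrite edge_up_eq; apply: contraNF nt => /eqP -> /=.
by rewrite eq_sym edge_up_down //=; apply: tree_edgeN.
Qed.

(** The fundamental cycle of the edge [p] with respect to the tree. *)
Definition loop (p : V * 'I_k) : chain 1 :=
  gen kappa (edge_up p) + tree_path p.1 - tree_path (flip p.1 p.2).

Lemma loop_cycle p : loop p \in @cycles R kappa X 1.
Proof.
rewrite inE /loop linearB linearD /= !bd_tree_path bd_edge; apply/eqP.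
exact: scale_triangle.
Qed.

Lemma loop_coord i j : loop (e i) (edge_up (e j)) - loop (e i) (edge_down (e j)) = (j == i)%:R :> A.
Proof.
rewrite /loop !ffunE !tree_path_coord edge_up_eq (inj_eq e_inj) eq_sym.
have [[ei _] [ej _]] := (extra_edgeP i, extra_edgeP j).
by rewrite (eq_sym (edge_down _)) edge_up_down // !(addr0, subr0) eq_sym.
Qed.

Lemma coord1_surj (y : {ffun 'I_m -> bar12}) :
  exists2 z, z \in @cycles R kappa X 1 & coord1 z = y.
Proof.
exists (\sum_i (repr (y i) : A) *: loop (e i)).
  by apply: rpred_sum => i _; apply: rpredZ; apply: loop_cycle.
apply/ffunP => j; rewrite ffunE -[RHS]to_quotmodK; congr to_quotmod.
rewrite !sum_ffunE; under eq_bigr do rewrite ffunE.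
under [X in _ - X]eq_bigr do rewrite ffunE.
exact: (@dual_basis_sum A m (fun i => repr (y i)) (fun i => loop (e i) (edge_up (e j)))
  (fun i => loop (e i) (edge_down (e j))) j (fun i => loop_coord i j)).
Qed.

Lemma PH1_iso : graded_iso (PH kappa X 1) (gmod_power bar12 m).
Proof.
apply: (@PH_graded_iso R kappa X 1 (gmod_power bar12 m) coord1).
- exact: coord1_graded.
- exact: coord1_boundary.
- exact: coord1_bd_gen.
- exact: coord1_surj.
Qed.

End Degree1.
End TreePaths.

Theorem proposition4p10 (R : realType) (kappa : fieldType) (k : nat)
    (hk : (1 <= k)%N) :
  [/\ graded_iso (PH kappa (hamming_cube R k) 0)
        (gmod_dsum
          (gmod_power (bar kappa (nnreal_nat R 0) (nnreal_nat R 1)) (2 ^ k - 1)%N)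
          (bar_infty kappa (nnreal_nat R 0))),
      graded_iso (PH kappa (hamming_cube R k) 1)
        (gmod_power (bar kappa (nnreal_nat R 1) (nnreal_nat R 2))
          (k * 2 ^ (k - 1) - (2 ^ k - 1))%N)
    & forall x : PH kappa (hamming_cube R k) 2, x = 0].
Proof.
split.
- have card0 : #|[set~ origin k]| = (2 ^ k - 1)%N.
    by rewrite cardsC1 card_tuple card_bool subn1.
  by have [e [e_inj eP]] := enum_set card0; apply: (PH0_iso R kappa e_inj eP).
- have [e [e_inj eP]] := enum_set (card_extra_edges hk).
  exact: (PH1_iso R kappa e_inj eP).
exact/PH_eq0/cycles2_boundaries.
Qed.
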